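(* Consider a non-critical XOR Ising model, i.e. one with couplings $J_h,J_v>0$ satisfying $e^{-2J_h}+e^{-2J_v}+e^{-2J_h-2J_v}\neq1$. Then almost surely it has at most one infinite contour.
   Context: For $J_h,J_v>0$, the Ising model on $\mathbb{Z}^2$ (nearest-neighbour edges) with coupling $J_h$ on horizontal and $J_v$ on vertical edges and no external field is taken with the infinite-volume law obtained as the weak limit, as $n\to\infty$, of the Ising measures on $n\times n$ tori (periodic boundary conditions). The XOR Ising model is $\sigma_{XOR}(v)=\sigma_1(v)\sigma_2(v)$, where $\sigma_1,\sigma_2$ are independent copies of this Ising model (same $J_h,J_v$). The contour configuration is the set of edges of the dual lattice $(\mathbb{Z}+\tfrac12)^2$ crossing an edge of $\mathbb{Z}^2$ whose endpoints have different values of $\sigma_{XOR}$; a contour is a connected component of this set, infinite if it has infinitely many edges. *)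

(* Defs.v *)
From HB Require Import structures.
From Stdlib Require Import Relations.
From mathcomp Require Import all_boot all_order all_algebra.
From mathcomp Require Import all_classical all_reals all_analysis.
Set Implicit Arguments. Unset Strict Implicit. Unset Printing Implicit Defensive.
Import Order.TTheory GRing.Theory Num.Theory.
Local Open Scope classical_set_scope.
Local Open Scope ring_scope.

Definition vertex := (int * int)%type.
Definition spin (b : bool) {R : numDomainType} : R := if b then 1 else -1.

Definition cyl (Lam : seq vertex) (xi : vertex -> bool) : set (vertex -> bool) :=
  [set w | forall v, v \in Lam -> w v = xi v].

Definition cylinders : set (set (vertex -> bool)) :=
  [set A | exists Lam xi, A = cyl Lam xi].

Definition Omega := g_sigma_algebraType cylinders.

Definition tvertex (n : nat) := ('I_n.+1 * 'I_n.+1)%type.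
Definition tconfig (n : nat) := {ffun tvertex n -> bool}.

(* Hamiltonian (minus energy): sum over horizontal and vertical torus edges *)
Definition torus_H {R : realType} (Jh Jv : R) (n : nat) (t : tconfig n) : R :=
  Jh * (\sum_(x : tvertex n) spin (t x) * spin (t (ordS x.1, x.2)))
  + Jv * (\sum_(x : tvertex n) spin (t x) * spin (t (x.1, ordS x.2))).

Definition torus_weight {R : realType} (Jh Jv : R) n (t : tconfig n) : R :=
  expR (torus_H Jh Jv t).

Definition torus_proj (n : nat) (v : vertex) : tvertex n :=
  (inord `|(v.1 %% (n.+1)%:Z)%Z|%N, inord `|(v.2 %% (n.+1)%:Z)%Z|%N).

Definition torus_cyl_prob {R : realType} (Jh Jv : R) (n : nat)
    (Lam : seq vertex) (xi : vertex -> bool) : R :=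
  (\sum_(t : tconfig n | all (fun v => t (torus_proj n v) == xi v) Lam)
      torus_weight Jh Jv t)
  / (\sum_(t : tconfig n) torus_weight Jh Jv t).

(* P is the weak limit of the torus Ising measures as the torus size grows:
   on the compact space {-1,1}^{Z^2}, weak convergence is convergence of the
   probabilities of all cylinder events. *)
Definition is_torus_Ising_limit {R : realType} (Jh Jv : R)
    (P : probability Omega R) : Prop :=
  forall (Lam : seq vertex) (xi : vertex -> bool),
    ((fun n => (torus_cyl_prob Jh Jv n Lam xi)%:E) @ \oo --> P (cyl Lam xi))%E.

Definition xor_spin (w : Omega * Omega) (v : vertex) : bool := w.1 v == w.2 v.

(* Dual vertex (a,b) stands for (a+1/2, b+1/2).  A dual edge is a dual vertex p
   with a direction: (p,false) joins p to p+(1,0), (p,true) joins p to p+(0,1). *)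
Definition dual_edge := ((int * int) * bool)%type.

Definition dual_ends (e : dual_edge) : (int * int) * (int * int) :=
  let: ((a, b), d) := e in
  if d then ((a, b), (a, b + 1)) else ((a, b), (a + 1, b)).

Definition crossed (e : dual_edge) : vertex * vertex :=
  let: ((a, b), d) := e in
  if d then ((a, b + 1), (a + 1, b + 1))
  else ((a + 1, b), (a + 1, b + 1)).

Definition contour_config (s : vertex -> bool) : set dual_edge :=
  [set e | s (crossed e).1 != s (crossed e).2].

Definition share_endpoint (e f : dual_edge) : Prop :=
  (dual_ends e).1 = (dual_ends f).1 \/ (dual_ends e).1 = (dual_ends f).2 \/
  (dual_ends e).2 = (dual_ends f).1 \/ (dual_ends e).2 = (dual_ends f).2.

Definition connected_in (C : set dual_edge) (e f : dual_edge) : Prop :=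
  C e /\ C f /\
  clos_refl_trans dual_edge (fun a b => C a /\ C b /\ share_endpoint a b) e f.

Definition contour_of (C : set dual_edge) (e : dual_edge) : set dual_edge :=
  [set f | connected_in C e f].

Definition infinite_contour_at (C : set dual_edge) (e : dual_edge) : Prop :=
  C e /\ ~ finite_set (contour_of C e).

Definition at_most_one_infinite_contour (C : set dual_edge) : Prop :=
  forall e f, infinite_contour_at C e -> infinite_contour_at C f ->
    connected_in C e f.

(* Main.v *)
Require Import Defs.
From HB Require Import structures.
From Stdlib Require Import Relations.
From mathcomp Require Import all_boot all_order all_algebra.
From mathcomp Require Import all_classical all_reals all_analysis.
From mathcomp Require Import zify ring lra.
Set Implicit Arguments. Unset Strict Implicit. Unset Printing Implicit Defensive.
Import Order.TTheory GRing.Theory Num.Theory.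
Local Open Scope classical_set_scope.
Local Open Scope ring_scope.

(* The argument is that of Burton and Keane. The law Q of the XOR spins is
   translation invariant, and flipping one spin multiplies probabilities by at
   most a constant, because this holds for the torus measures. Hence events of
   probability zero stay so after finitely many spins are modified, and an
   invariant event is, up to probability zero, insensitive to such
   modifications. Inside a large square the spins can be rearranged into a
   chessboard (with a phase for each quadrant) so that all contours meeting the
   square merge.
   If there were three infinite contours with positive probability, such a
   merger would give with positive probability a hub: a square whose removal
   splits a contour into at least three infinite pieces. Disjoint hubs inject
   into the boundary of any region containing them, so they have density zero,
   a contradiction. If there were exactly two infinite contours, which is an
   invariant event, a merger would leave at most one, against insensitivity. *)

(** * The torus measures *)

(** Contour edges cannot be switched one at a time: an even number of them meets at every dual
    vertex, and the only local moves are spin flips. This is why contours are merged by rewriting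
    all spins of a square, and why the branching object is a whole square instead of a single
    trifurcation vertex. The rewriting may cut old contours apart inside the square. This is
    harmless, because an edge with an end outside the square keeps its status: whatever arrived from
    outside still arrives, and then meets the connected pattern inside. The number of infinite
    contours is not known to be almost surely constant, so [three_contours] (at least three) and
    [two_contours] without [three_contours] (exactly two) are treated as separate invariant events.
    The first is killed by counting, the second by insensitivity. Both cases are exhausted by
    countably many squares, so null sets suffice and no positive lower bound is carried along. *)

Definition translate (u : vertex) (w : Omega) : Omega := fun v => w (v + u).
Definition flip_spin (v : vertex) (w : Omega) : Omega := fun u => if u == v then ~~ w u else w u.

Lemma translate_cyl u Lam xi :
  translate u @^-1` cyl Lam xi = cyl [seq v + u | v <- Lam] (fun v => xi (v - u)).
Proof.
apply/seteqP; split=> w /= h v; first by move=> /mapP[x xL ->]; rewrite addrK -h.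
by move=> vL; rewrite /translate h ?addrK//; apply: map_f.
Qed.

Lemma flip_cyl v Lam xi : v \in Lam ->
  flip_spin v @^-1` cyl Lam xi = cyl Lam (flip_spin v xi).
Proof.
move=> vL; apply/seteqP; split=> w /= h u uL; have := h u uL; rewrite /flip_spin;
by case: eqP => // _; case: (w u); case: (xi u).
Qed.

Lemma flip_cyl_notin v Lam xi : v \notin Lam -> flip_spin v @^-1` cyl Lam xi = cyl Lam xi.
Proof.
move=> vL; apply/seteqP; split=> w /= h u uL; have := h u uL; rewrite /flip_spin;
by case: eqP => // uv; move: vL; rewrite -uv uL.
Qed.

Section torus.
Context {R : realType}.
Variables (Jh Jv : R) (n : nat).
Implicit Types (t : tconfig n) (x p : tvertex n).

Definition east x : tvertex n := (ordS x.1, x.2).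
Definition north x : tvertex n := (x.1, ordS x.2).

Lemma east_inj : injective east.
Proof.
move=> [a b] [c d] h.
by rewrite (ordS_inj (congr1 fst h : ordS a = ordS c)) (congr1 snd h : b = d).
Qed.

Lemma north_inj : injective north.
Proof.
move=> [a b] [c d] h.
by rewrite (ordS_inj (congr1 snd h : ordS b = ordS d)) (congr1 fst h : a = c).
Qed.

Lemma torus_H_E t : torus_H Jh Jv t =
  \sum_x (Jh * (spin (t x) * spin (t (east x))) + Jv * (spin (t x) * spin (t (north x)))).
Proof. by rewrite /torus_H !mulr_sumr -big_split. Qed.

Lemma torus_weight_rot (rot : tvertex n -> tvertex n) t : injective rot ->
  (forall x, rot (east x) = east (rot x)) -> (forall x, rot (north x) = north (rot x)) ->
  torus_weight Jh Jv [ffun x => t (rot x)] = torus_weight Jh Jv t.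
Proof.
move=> irot re rn; rewrite /torus_weight !torus_H_E [in RHS](reindex_inj irot) /=.
by congr expR; apply: eq_bigr => x _; rewrite !ffunE re rn.
Qed.

Lemma torus_cyl_prob_rot (rot : tvertex n -> tvertex n) u Lam xi : injective rot ->
  (forall x, rot (east x) = east (rot x)) -> (forall x, rot (north x) = north (rot x)) ->
  (forall v, torus_proj n (v + u) = rot (torus_proj n v)) ->
  torus_cyl_prob Jh Jv n [seq v + u | v <- Lam] (fun v => xi (v - u)) =
  torus_cyl_prob Jh Jv n Lam xi.
Proof.
move=> irot re rn proju; rewrite /torus_cyl_prob; congr (_ / _).
pose F t : tconfig n := [ffun x => t (rot x)].
have iF : injective F.
  have [rot' rK rK'] := injF_bij irot.
  move=> t t' /ffunP tt'; apply/ffunP => x; have := tt' (rot' x); rewrite !ffunE.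
  by rewrite rK'.
rewrite [RHS](reindex_inj iF) /=; apply: eq_big => [t|t _].
  rewrite all_map; apply: eq_all => v /=.
  by rewrite proju addrK ffunE.
by rewrite torus_weight_rot.
Qed.

Lemma torus_coord_succ (a : int) :
  inord (absz ((a + 1) %% n.+1%:Z)%Z) = ordS (inord (absz (a %% n.+1%:Z)%Z)) :> 'I_n.+1.
Proof.
have lt b : (absz (b %% n.+1%:Z)%Z < n.+1)%N by have := ltz_pmod b (isT : 0 < n.+1%:Z); lia.
apply/val_inj; rewrite /= !inordK ?lt//.
have h : (absz (a %% n.+1%:Z)%Z).+1%:Z = (a %% n.+1%:Z)%Z + 1 by lia.
apply/eqP; rewrite -eqz_nat -modz_nat h modzDml.
by have := modz_ge0 (a + 1) (isT : n.+1%:Z != 0); lia.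
Qed.

Lemma torus_proj_east v : torus_proj n (v + (1, 0)) = east (torus_proj n v).
Proof. by case: v => a b; rewrite /torus_proj /east /= torus_coord_succ addr0. Qed.

Lemma torus_proj_north v : torus_proj n (v + (0, 1)) = north (torus_proj n v).
Proof. by case: v => a b; rewrite /torus_proj /north /= torus_coord_succ addr0. Qed.

Definition tflip p t : tconfig n := [ffun x => if x == p then ~~ t x else t x].

Lemma tflipK p : involutive (tflip p).
Proof. by move=> t; apply/ffunP => x; rewrite !ffunE; case: eqP => // _; rewrite negbK. Qed.

(** A flip at [p] affects at most two summands, the one at [p] and the one whose neighbour is [p],
    and each product of two signs moves by at most 2; hence the 4. *)
Lemma nbr_tflip (nbr : tvertex n -> tvertex n) p t : injective nbr ->
  \sum_x (spin (tflip p t x) * spin (tflip p t (nbr x))) <=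
  \sum_x (spin (t x) * spin (t (nbr x))) + 4 :> R.
Proof.
move=> inbr.
have [nbr' nK nK'] := injF_bij inbr.
rewrite -lerBlDl -sumrB.
have -> : 4 = \sum_(x : tvertex n) ((if x == p then 2 else 0) + (if x == nbr' p then 2 else 0)) :> R.
  by rewrite big_split /= -!big_mkcond /= !big_pred1_eq -natrD.
apply: ler_sum => x _; rewrite !ffunE.
have -> : (nbr x == p) = (x == nbr' p) by rewrite -[RHS](inj_eq inbr) nK'.
by case: eqP => _; case: eqP => _; case: (t x); case: (t (nbr x)); rewrite /spin /=; lra.
Qed.

Lemma torus_weight_tflip p t : 0 < Jh -> 0 < Jv ->
  torus_weight Jh Jv (tflip p t) <= expR (4 * (Jh + Jv)) * torus_weight Jh Jv t.
Proof.
move=> Jh0 Jv0; rewrite /torus_weight -expRD ler_expR /torus_H.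
have hE := ler_wpM2l (ltW Jh0) (nbr_tflip p t east_inj).
have hN := ler_wpM2l (ltW Jv0) (nbr_tflip p t north_inj).
apply: le_trans (lerD hE hN) _.
by rewrite -subr_ge0 le_eqVlt; apply/orP; left; apply/eqP; ring.
Qed.

(** The last hypothesis excludes wrap-around: on a small torus another vertex of [Lam] may project
    to the same point as [v], and the flip would also change the value prescribed there. By
    [torus_proj_inj_near] it holds on all large tori. *)
Lemma torus_cyl_prob_flip v Lam xi : 0 < Jh -> 0 < Jv ->
  (forall u, u \in Lam -> torus_proj n u = torus_proj n v -> u = v) ->
  torus_cyl_prob Jh Jv n Lam (flip_spin v xi) <=
  expR (4 * (Jh + Jv)) * torus_cyl_prob Jh Jv n Lam xi.
Proof.
move=> Jh0 Jv0 injv; rewrite /torus_cyl_prob mulrA ler_pM2r; last first.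
  rewrite invr_gt0; apply: (@lt_le_trans _ _ (torus_weight Jh Jv [ffun=> true])).
    exact: expR_gt0.
  rewrite (bigD1 [ffun=> true])//=; apply: ler_wpDr => //.
  by apply: sumr_ge0 => t _; exact: expR_ge0.
rewrite (reindex_inj (inv_inj (@tflipK (torus_proj n v)))) /= mulr_sumr.
rewrite [leLHS](_ : _ = \sum_(t : tconfig n | all (fun v => t (torus_proj n v) == xi v) Lam)
    torus_weight Jh Jv (tflip (torus_proj n v) t)).
  by apply: ler_sum => t _; exact: torus_weight_tflip.
apply: eq_bigl => t; apply: eq_in_all => u uL; rewrite ffunE /flip_spin.
have [->|uv] := eqVneq u v; first by rewrite eqxx; case: (t _); case: (xi _).
by case: (torus_proj n u =P torus_proj n v) => // /(injv u uL) e; rewrite e eqxx in uv.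
Qed.

End torus.

Lemma torus_proj_inj_near (v : vertex) (Lam : seq vertex) :
  \forall n \near \oo, forall u, u \in Lam -> torus_proj n u = torus_proj n v -> u = v.
Proof.
elim: Lam => [|u Lam IH]; first by apply: nearW.
near=> n => w; rewrite inE => /orP[/eqP ->|wL]; last first.
  by move: w wL; near: n.
have nb : (absz (u.1 - v.1) + absz (u.2 - v.2) < n.+1)%N.
  by near: n; exists (absz (u.1 - v.1) + absz (u.2 - v.2))%N => // k /=; rewrite ltnS.
have coord (a b : int) : (absz (a - b)%R < n.+1)%N ->
    inord (absz (a %% n.+1%:Z)%Z) = inord (absz (b %% n.+1%:Z)%Z) :> 'I_n.+1 -> a = b.
  have lt c : (absz (c %% n.+1%:Z)%Z < n.+1)%N by have := ltz_pmod c (isT : 0 < n.+1%:Z); lia.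
  move=> ab /(congr1 val); rewrite /= !inordK ?lt// => e.
  have e' : (a %% n.+1%:Z)%Z = (b %% n.+1%:Z)%Z.
    have := modz_ge0 a (isT : n.+1%:Z != 0); have := modz_ge0 b (isT : n.+1%:Z != 0); lia.
  have : (n.+1%:Z %| a - b)%Z by rewrite -eqz_mod_dvd; apply/eqP.
  move=> /dvdzP[q qE]; have [q0|q0] := eqVneq q 0; first by rewrite q0 mul0r in qE; lia.
  by move: ab; rewrite qE abszM /= ltnNge -[leqLHS]mul1n leq_mul2r absz_gt0 q0 orbT.
move=> h; have n1 : (absz (u.1 - v.1)%R < n.+1)%N by exact: leq_ltn_trans (leq_addr _ _) nb.
have n2 : (absz (u.2 - v.2)%R < n.+1)%N by exact: leq_ltn_trans (leq_addl _ _) nb.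
have e1 := coord _ _ n1 (congr1 fst h); have e2 := coord _ _ n2 (congr1 snd h).
by rewrite [u]surjective_pairing [v]surjective_pairing e1 e2.
Unshelve. all: by end_near. Qed.

Section limit.
Context {R : realType}.
Variables (Jh Jv : R) (P : probability Omega R).
Hypotheses (Jh0 : 0 < Jh) (Jv0 : 0 < Jv) (PJ : is_torus_Ising_limit Jh Jv P).

Lemma ising_translate_cyl u Lam xi : u = (1, 0) \/ u = (0, 1) ->
  P (translate u @^-1` cyl Lam xi) = P (cyl Lam xi).
Proof.
move=> hu; rewrite translate_cyl.
have <- := cvg_lim (@ereal_hausdorff R) (@PJ Lam xi).
have <- := cvg_lim (@ereal_hausdorff R) (@PJ [seq v + u | v <- Lam] (fun v => xi (v - u))).
congr (lim (_ @ \oo)); apply/funext => n; congr EFin; case: hu => ->.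
  by apply: (@torus_cyl_prob_rot _ _ _ n (@east n)) => // [|v]; [exact: east_inj|exact: torus_proj_east].
by apply: (@torus_cyl_prob_rot _ _ _ n (@north n)) => // [|v]; [exact: north_inj|exact: torus_proj_north].
Qed.

Lemma ising_flip_cyl v Lam xi :
  (P (flip_spin v @^-1` cyl Lam xi) <= (expR (4 * (Jh + Jv)))%:E * P (cyl Lam xi))%E.
Proof.
have [vL|vL] := boolP (v \in Lam); last first.
  rewrite flip_cyl_notin// lee_pemull// lee_fin -expR0 ler_expR.
  by rewrite mulr_ge0// addr_ge0// ltW.
rewrite flip_cyl//; apply: (lee_cvg_to (@PJ Lam (flip_spin v xi))).
  by apply: cvgeZl => //; exact: (@PJ Lam xi).
near=> n; rewrite -EFinM lee_fin; apply: torus_cyl_prob_flip => //.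
by near: n; exact: torus_proj_inj_near.
Unshelve. all: by end_near. Qed.
End limit.

(** * Approximation by local events *)

Section local_events.
Implicit Types (A B : set Omega) (Lam : seq vertex).

Definition local_event Lam B :=
  forall w w' : Omega, {in Lam, w =1 w'} -> B w -> B w'.

(** Splitting on the spin at one vertex of [Lam] after another cuts a local event into finitely many
    disjoint cylinders. Disjointness is what lets inequalities between measures pass from cylinders
    to local events by addition. *)
Lemma local_ind (Pr : set Omega -> Prop) :
  Pr set0 -> (forall Lam xi, Pr (cyl Lam xi)) ->
  (forall A B, A `&` B = set0 -> Pr A -> Pr B -> Pr (A `|` B)) ->
  forall Lam B, local_event Lam B -> Pr B.
Proof.
move=> Pr0 Prcyl PrU Lam B BL.
(* [Lam] lists the vertices still to be split on, [Lam'] those whose spins are already fixed by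
   [xi]. *)
suff H : forall Lam Lam' xi, local_event (Lam ++ Lam') B -> Pr (B `&` cyl Lam' xi).
  have -> : B = B `&` cyl [::] (fun=> true).
    by apply/seteqP; split=> [w Bw|w []//]; split.
  by apply: (H Lam); rewrite cats0.
clear Lam BL; elim=> [|v Lam IH] Lam' xi BL.
  have [Bxi|Bxi] := pselect (B xi).
    rewrite setIidr//; move=> w /= wxi; apply: (BL xi) => // u uL.
    by rewrite wxi.
  rewrite [X in Pr X](_ : _ = set0)//; apply/seteqP; split=> // w [Bw wxi].
  by apply: Bxi; apply: (BL w).
have [vL|vL] := boolP (v \in Lam').
  apply: IH => w w' ww'; apply: BL => u; rewrite /= inE => /orP[/eqP ->|/ww'//].
  by apply: ww'; rewrite mem_cat vL orbT.
pose xib b : vertex -> bool := fun u => if u == v then b else xi u.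
have -> : B `&` cyl Lam' xi =
    (B `&` cyl (v :: Lam') (xib true)) `|` (B `&` cyl (v :: Lam') (xib false)).
  rewrite -setIUr; congr (_ `&` _); apply/seteqP; split=> w.
    have wE b : cyl Lam' xi w -> w v = b -> cyl (v :: Lam') (xib b) w.
      move=> wxi wv u; rewrite inE /xib; case: eqP => [->//|_ /=]; exact: wxi.
    by move=> wxi; case wv : (w v); [left|right]; apply: wE.
  have wE b : cyl (v :: Lam') (xib b) w -> cyl Lam' xi w.
    move=> wxi u uL; have := wxi u; rewrite inE uL orbT /xib => -> //.
    by case: eqP => // uv; move: vL; rewrite -uv uL.
  by case=> /wE.
apply: PrU.
- apply/seteqP; split=> // w [[_ /(_ v)] + [_ /(_ v)]] /=.
  by rewrite inE eqxx /xib eqxx => -> // /(_ isT).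
- apply: IH => w w' ww'; apply: BL => u; rewrite /= inE => uL; apply: ww'.
  by move: uL; rewrite !mem_cat inE => /or3P[->|->|->]; rewrite ?orbT.
- apply: IH => w w' ww'; apply: BL => u; rewrite /= inE => uL; apply: ww'.
  by move: uL; rewrite !mem_cat inE => /or3P[->|->|->]; rewrite ?orbT.
Qed.

Lemma measurable_cyl Lam xi : measurable (cyl Lam xi : set Omega).
Proof. by apply: sub_sigma_algebra; exists Lam, xi. Qed.

Lemma measurable_local Lam B : local_event Lam B -> measurable B.
Proof.
apply: local_ind => //; first exact: measurable_cyl.
by move=> ? ? _; exact: measurableU.
Qed.

Section approximation.
Context {R : realType} (mu : {measure set Omega -> \bar R}).
Hypothesis mu_fin : (mu setT < +oo)%E.
Local Open Scope ereal_scope.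

Let approximable A := measurable A /\ forall eps : R, (0 < eps)%R ->
  exists Lam B, local_event Lam B /\ mu ((A `\` B) `|` (B `\` A)) <= eps%:E.

Let approximableU A1 A2 : approximable A1 -> approximable A2 -> approximable (A1 `|` A2).
Proof.
move=> [mA1 hA1] [mA2 hA2]; split; first exact: measurableU.
move=> eps eps0; have eps20 : (0 < eps / 2)%R by rewrite divr_gt0.
have [L1 [B1 [LB1 h1]]] := hA1 _ eps20; have [L2 [B2 [LB2 h2]]] := hA2 _ eps20.
have mB1 := measurable_local LB1; have mB2 := measurable_local LB2.
exists (L1 ++ L2), (B1 `|` B2); split.
  move=> w w' ww' [Bw|Bw]; [left; apply: LB1 Bw|right; apply: LB2 Bw] => u uL;
  by apply: ww'; rewrite mem_cat uL ?orbT.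
rewrite [eps]splitr EFinD; apply: le_trans (leeD h1 h2).
apply: le_trans (measureU2 _ _ _); [|by apply: measurableU; apply: measurableD..].
apply: le_measure; rewrite ?inE.
- by apply: measurableU; apply: measurableD; apply: measurableU.
- by apply: measurableU; apply: measurableU; apply: measurableD.
- move=> w [[[A1w|A2w] /not_orP[B1w B2w]]|[[B1w|B2w] /not_orP[A1w A2w]]].
  + by left; left.
  + by right; left.
  + by left; right.
  + by right; right.
Qed.

Let approximable_bigsetU (F : (set Omega)^nat) n :
  (forall k, approximable (F k)) -> approximable (\big[setU/set0]_(k < n) F k).
Proof.
move=> aF; elim: n => [|n IH]; last by rewrite big_ord_recr; exact: approximableU.
rewrite big_ord0; split=> // eps eps0; exists [::], set0; split=> //.
by rewrite setD0 setU0 measure0 lee_fin ltW.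
Qed.

(** The sets that can be approximated form a sigma-algebra containing the cylinders. For a countable
    union, finiteness of [mu] allows truncation to a finite union at cost [eps / 2]. *)
Lemma local_approximation A : measurable A -> forall eps : R, (0 < eps)%R ->
  exists Lam B, local_event Lam B /\ mu ((A `\` B) `|` (B `\` A)) <= eps%:E.
Proof.
move=> mA; suff [] : approximable A by [].
move: A mA; apply: smallest_sub; last first.
  move=> _ [Lam [xi ->]]; split; first exact: measurable_cyl.
  move=> eps eps0; exists Lam, (cyl Lam xi); split.
    by move=> w w' ww' wxi v vL; rewrite -ww'// wxi.
  by rewrite setDv setU0 measure0 lee_fin ltW.
split.
- split=> // eps eps0; exists [::], set0; split=> //.
  by rewrite setD0 setU0 measure0 lee_fin ltW.
- move=> A [mA hA]; split; first exact: measurableD.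
  move=> eps /hA[Lam [B [LB h]]]; exists Lam, (~` B); split.
    by move=> w w' ww' Bw B'w; apply: Bw; apply: LB B'w => u uL; rewrite ww'.
  rewrite setTD [X in mu X](_ : _ = (A `\` B) `|` (B `\` A))//.
  by rewrite !setDE !setCK setUC; congr setU; rewrite setIC.
- move=> F' aF'; pose F : (set Omega)^nat := F'; have aF : forall k, approximable (F k) := aF'.
  rewrite -[\bigcup_k _]/(\bigcup_k F k); have mF k : measurable (F k) by case: (aF k).
  split; first exact: bigcupT_measurable.
  move=> eps eps0; have eps20 : (0 < eps / 2)%R by rewrite divr_gt0.
  pose U n := \big[setU/set0]_(k < n) F k.
  have mU n : measurable (U n) by apply: bigsetU_measurable.
  pose D n := (\bigcup_k F k) `\` U n.
  have mD n : measurable (D n) by apply: measurableD => //; exact: bigcupT_measurable.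
  have [n Dn] : exists n, mu (D n) <= (eps / 2)%:E.
    apply: contrapT => noD.
    have D0 : \bigcap_n D n = set0.
      apply/seteqP; split=> // w Dw; have [[k _ Fk] _] := Dw 0%N I.
      have [_] := Dw k.+1 I; apply; rewrite /U -bigcup_mkord; exists k => //=.
    have cvg : mu \o D @ \oo --> mu (\bigcap_n D n).
      apply: nonincreasing_cvg_mu.
      - by apply: le_lt_trans mu_fin; apply: le_measure; rewrite ?inE.
      - by [].
      - by rewrite D0.
      - move=> a b ab; apply/subsetPset => w [Fw Ubw]; split=> // Uaw; apply: Ubw.
        move: Uaw; rewrite /U -!bigcup_mkord => -[k ka Fk]; exists k => //=.
        exact: leq_trans ka ab.
    have : (eps / 2)%:E <= mu (\bigcap_n D n).
      apply: (cvge_ge _ cvg); apply: nearW => n; apply: ltW; rewrite ltNge.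
      by apply/negP => h; apply: noD; exists n.
    by rewrite D0 measure0 lee_fin leNgt eps20.
  have [_ /(_ _ eps20)[L [B [LB hB]]]] := approximable_bigsetU n aF.
  have mB := measurable_local LB.
  exists L, B; split=> //; rewrite [eps]splitr EFinD; apply: le_trans (leeD Dn hB).
  have mS : measurable ((U n `\` B) `|` (B `\` U n)) by apply: measurableU; apply: measurableD.
  apply: le_trans (measureU2 _ (mD n) mS).
  apply: le_measure; rewrite ?inE.
  + by apply: measurableU; apply: measurableD => //; exact: bigcupT_measurable.
  + by apply: measurableU => //; apply: measurableU; apply: measurableD.
  + move=> w [[Fw Bw]|[Bw Fw]].
      by have [Uw|Uw] := pselect (U n w); [right; left|left].
    right; right; split=> // Uw; apply: Fw; move: Uw; rewrite /U -bigcup_mkord.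
    by case=> k _ Fk; exists k.
Qed.
End approximation.

Section domination.
Context {R : realType} (m1 m2 : {measure set Omega -> \bar R}) (c : R).
Local Open Scope ereal_scope.
Hypotheses (m1_fin : m1 setT < +oo) (m2_fin : m2 setT < +oo) (c0 : (0 <= c)%R).
Hypothesis cyl_le : forall Lam xi, m1 (cyl Lam xi) <= c%:E * m2 (cyl Lam xi).

Lemma dominated_local Lam B : local_event Lam B -> m1 B <= c%:E * m2 B.
Proof.
move=> LB; suff [] : measurable B /\ m1 B <= c%:E * m2 B by [].
apply: (@local_ind (fun B => measurable B /\ m1 B <= c%:E * m2 B) _ _ _ _ _ LB).
- by rewrite !measure0 mule0.
- by move=> L xi; split; [exact: measurable_cyl|exact: cyl_le].
- move=> A A' AA' [mA hA] [mA' hA']; split; first exact: measurableU.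
  rewrite !measureU// ge0_muleDr//; exact: leeD.
Qed.

(** The approximation is made for [m1 + m2], so that one local event is close to [A] for both
    measures at once. The total error is [m1 S + c * m2 S], at most [c + 1] times the measure of the
    symmetric difference [S]; this explains the precision [eps / (c + 1)]. *)
Lemma dominated_measurable A : measurable A -> m1 A <= c%:E * m2 A.
Proof.
move=> mA; apply/lee_addgt0Pr => eps eps0.
have c1 : (0 < c + 1)%R by rewrite ltr_wpDl.
pose m12 : {measure set Omega -> \bar R} := measure_add m1 m2.
have m12E X : m12 X = m1 X + m2 X by exact: measure_addE.
have [] := @local_approximation _ m12 _ A mA (eps / (c + 1)).
- by rewrite m12E lte_add_pinfty.
- by rewrite divr_gt0.
move=> L [B [LB]]; rewrite m12E => h.
have mB := measurable_local LB.
set S := _ `|` _ in h; have mS : measurable S by apply: measurableU; apply: measurableD.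
have le (m : {measure set Omega -> \bar R}) X Y : measurable X -> measurable Y ->
    X `<=` Y `|` S -> m X <= m Y + m S.
  move=> mX mY XYS; apply: le_trans (measureU2 _ mY mS).
  by apply: le_measure; rewrite ?inE//; exact: measurableU.
have AB : A `<=` B `|` S.
  by move=> w Aw; have [Bw|Bw] := pselect (B w); [left|right; left].
have BA : B `<=` A `|` S.
  by move=> w Bw; have [Aw|Aw] := pselect (A w); [left|right; right].
have S1 : m1 S + c%:E * m2 S <= eps%:E.
  apply: (@le_trans _ _ ((c + 1)%:E * (m1 S + m2 S))).
    rewrite ge0_muleDr//; apply: leeD.
      by rewrite lee_pemull// lee_fin lerDr.
    by apply: lee_pmul => //; rewrite lee_fin lerDl.
  rewrite -lee_pdivlMl//; apply: le_trans h _.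
  by rewrite -EFinM lee_fin mulrC.
apply: le_trans (le m1 _ _ mA mB AB) _.
apply: (@le_trans _ _ (c%:E * (m2 A + m2 S) + m1 S)).
  apply: leeD => //; apply: le_trans (dominated_local LB) _.
  by apply: lee_wpmul2l => //; exact: le.
rewrite ge0_muleDr// -addeA; apply: leeD => //.
by rewrite addeC.
Qed.
End domination.

End local_events.

Lemma measurable_to_Omega d (T : measurableType d) (f : T -> Omega) :
  (forall v, measurable [set t | f t v]) -> measurable_fun setT f.
Proof.
move=> mf; apply: (@measurability _ _ T Omega setT f cylinders) => // _ [_ [Lam [xi ->]] <-].
rewrite setTI; have mb v b : measurable [set t | f t v = b].
  case: b; first exact: mf.
  rewrite (_ : [set _ | _] = ~` [set t | f t v]); first exact/measurableC/mf.
  by apply/seteqP; split=> t /=; [move=> ->|move/negP/negbTE].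
elim: Lam => [|v Lam IH].
  by rewrite (_ : _ @^-1` _ = setT)//; apply/seteqP; split.
rewrite (_ : _ @^-1` _ = [set t | f t v = xi v] `&` (f @^-1` cyl Lam xi)).
  by apply: measurableI.
apply/seteqP; split=> t /=.
  by move=> h; split=> [|u uL]; apply: h; rewrite inE ?eqxx ?uL ?orbT.
by move=> [hv h] u; rewrite inE => /orP[/eqP ->//|/h].
Qed.

Lemma measurable_coord v : measurable [set w : Omega | w v].
Proof. by apply: (@measurable_local [:: v]) => w w' /= ww'; rewrite ww' ?mem_head. Qed.

Lemma measurable_translate u : measurable_fun setT (translate u).
Proof. by apply: measurable_to_Omega => v; exact: measurable_coord. Qed.

Lemma measurable_flip v : measurable_fun setT (flip_spin v).
Proof.
apply: measurable_to_Omega => u; apply: (@measurable_local [:: u]) => w w' /= ww'.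
by rewrite /flip_spin ww' ?mem_head.
Qed.

(** * Finite energy and translation invariance of the XOR law *)

(* [pushforward] is a measure only given a proof of measurability, which unification
   cannot find. *)
Definition image_measure d d' (T1 : measurableType d) (T2 : measurableType d')
    (R : realType) (m : {measure set T1 -> \bar R}) (f : T1 -> T2)
    (mf : measurable_fun setT f) : {measure set T2 -> \bar R} :=
  measure_function_pushforward__canonical__measure_function_Measure m mf.

Lemma image_measureE d d' (T1 : measurableType d) (T2 : measurableType d')
    (R : realType) (m : {measure set T1 -> \bar R}) (f : T1 -> T2)
    (mf : measurable_fun setT f) A : image_measure m mf A = m (f @^-1` A).
Proof. by []. Qed.

Lemma translate_away (L : seq vertex) (v u : vertex) : u.1 != 0 ->
  (* An equality [x + u *+ n = v] would force the distance of [x.1] and [v.1] to be [n] times that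
     of [u.1] from 0; the chosen [n] exceeds all these distances. *)
  exists n, forall x, x \in L -> x + u *+ n != v.
Proof.
move=> u0; exists (\sum_(x <- L) absz (x.1 - v.1)%R).+1 => x xL; apply/eqP => xv.
have le : (absz (x.1 - v.1)%R <= \sum_(x <- L) absz (x.1 - v.1)%R)%N.
  by rewrite (big_rem x xL) leq_addr.
have fstMn (y : vertex) n : (y *+ n).1 = y.1 *+ n.
  by elim: n => // n IH; rewrite !mulrS /= IH.
have := congr1 fst xv; rewrite /= fstMn -mulr_natr.
move: le; set N := (\sum_(_ <- _) _)%N; rewrite natz => le e.
have {}e : x.1 - v.1 = - (u.1 * N.+1%:Z) by rewrite -e; ring.
move: le; rewrite e abszN abszM /= leqNgt => /negP; apply.
by rewrite -[leqLHS]mul1n leq_mul2r absz_gt0 u0 orbT.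
Qed.

Section insensitive.
Context {R : realType} (Q : {measure set Omega -> \bar R}) (c : R) (u : vertex).
Local Open Scope ereal_scope.
Hypotheses (Q_fin : Q setT < +oo) (c0 : (0 <= c)%R) (u0 : u.1 != 0 :> int).
Hypothesis Q_inv : forall A : set Omega, measurable A -> Q (translate u @^-1` A) = Q A.
Hypothesis Q_flip : forall v (A : set Omega), measurable A ->
  Q (flip_spin v @^-1` A) <= c%:E * Q A.

(* [A] is approximated by a local event, hence also by translates of this event,
   which ignore the spin at [v]. *)
Lemma invariant_event_insensitive (A : set Omega) v : measurable A ->
  translate u @^-1` A = A -> Q (A `\` flip_spin v @^-1` A) = 0.
Proof.
move=> mA Au; apply/eqP; rewrite eq_le measure_ge0 andbT.
apply/lee_addgt0Pr => eps eps0; rewrite add0e.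
have c1 : (0 < c + 1)%R by rewrite ltr_wpDl.
have [|L [B [LB h]]] := local_approximation Q_fin mA (_ : 0 < eps / (c + 1))%R.
  by rewrite divr_gt0.
have mB := measurable_local LB.
pose tr n := iter n (preimage (translate u)).
have mpre X : measurable X -> measurable (translate u @^-1` X).
  by move=> mX; rewrite -[X in measurable X]setTI; exact: measurable_translate.
have mfl X : measurable X -> measurable (flip_spin v @^-1` X).
  by move=> mX; rewrite -[X in measurable X]setTI; exact: measurable_flip.
have mtr n X : measurable X -> measurable (tr n X) by move=> mX; elim: n => //= n /mpre.
have trA n : tr n A = A by elim: n => //= n ->.
have trQ n X : measurable X -> Q (tr n X) = Q X.
  by move=> mX; elim: n => //= n <-; rewrite Q_inv//; exact: mtr.
have trD n X Y : tr n (X `\` Y) = tr n X `\` tr n Y by elim: n => //= n ->.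
have trE n X w : tr n X w <-> X (fun x => w (x + u *+ n)%R).
  elim: n w => [|n IH] w /=.
    by rewrite (_ : (fun x => _) = w)//; apply/funext => x; rewrite mulr0n addr0.
  rewrite /preimage /= IH (_ : (fun x => translate u w _) = fun x => w (x + u *+ n.+1)%R)//.
  by apply/funext => x; rewrite /translate mulrSr addrA.
have [n nv] := translate_away L v u0.
have flB : flip_spin v @^-1` (tr n B) = tr n B.
  apply/seteqP; split=> w /=; rewrite !trE; apply: LB => x xL; rewrite /flip_spin;
  by rewrite (negbTE (nv x xL)).
(* The translate [tr n B] does not see the spin at [v], so it contains both [w] and its flip or
   neither. In the first case the flip lies in it but not in [A]; in the second [w] lies in [A] but
   not in it. As [A] is invariant, these are translates of the two halves of the approximation
   error. *)
have AB : A `\` flip_spin v @^-1` A `<=` tr n (A `\` B) `|` flip_spin v @^-1` tr n (B `\` A).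
  move=> w [Aw nAw]; have [Bw|Bw] := pselect (tr n B w).
    by right; rewrite trD trA; split=> //; move: Bw; rewrite -{1}flB.
  by left; rewrite trD trA; split.
have mAB := measurableD mA mB; have mBA := measurableD mB mA.
apply: le_trans (_ : Q (tr n (A `\` B) `|` flip_spin v @^-1` tr n (B `\` A)) <= _).
  apply: le_measure => //; rewrite inE; first exact: measurableD mA (mfl _ mA).
  exact: measurableU (mtr _ _ mAB) (mfl _ (mtr _ _ mBA)).
apply: le_trans (measureU2 _ (mtr _ _ mAB) (mfl _ (mtr _ _ mBA))) _.
apply: le_trans (leeD (lexx _) (Q_flip _ (mtr _ _ mBA))) _.
rewrite [X in X + _](trQ _ _ mAB) [X in _ * X](trQ _ _ mBA); set S := Q (_ `|` _) in h.
have SA : Q (A `\` B) <= S by apply: le_measure => //; rewrite ?inE//; exact: measurableU.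
have SB : Q (B `\` A) <= S by apply: le_measure => //; rewrite ?inE//; exact: measurableU.
apply: (@le_trans _ _ (S + c%:E * S)).
  by apply: leeD => //; exact: lee_wpmul2l.
have -> : S + c%:E * S = (c + 1)%:E * S.
  by rewrite addrC EFinD ge0_muleDl ?mul1e// lee_fin.
by rewrite -lee_pdivlMl//; apply: le_trans h _; rewrite -EFinM lee_fin mulrC.
Qed.

End insensitive.

Section ising.
Context {R : realType} (Jh Jv : R) (P : probability Omega R).
Hypotheses (Jh0 : 0 < Jh) (Jv0 : 0 < Jv) (PJ : is_torus_Ising_limit Jh Jv P).
Local Open Scope ereal_scope.

Let P_fin : P setT < +oo. Proof. by rewrite probability_setT ltry. Qed.

Lemma ising_translate (u : vertex) (A : set Omega) : u = (1, 0)%R \/ u = (0, 1)%R -> measurable A ->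
  P (translate u @^-1` A) = P A.
Proof.
move=> hu mA; pose P' : {measure set Omega -> \bar R} := image_measure P (measurable_translate u).
have P'fin : P' setT < +oo by rewrite image_measureE preimage_setT.
apply/eqP; rewrite eq_le; apply/andP; split.
  rewrite -[leRHS]mul1e; apply: (@dominated_measurable _ P' P) => // L xi.
  by rewrite mul1e le_eqVlt (_ : P' _ = P (cyl L xi)) ?eqxx//; exact: (ising_translate_cyl PJ).
rewrite -[leRHS]mul1e; apply: (@dominated_measurable _ P P') => // L xi.
by rewrite mul1e le_eqVlt (_ : P' _ = P (cyl L xi)) ?eqxx//; exact: (ising_translate_cyl PJ).
Qed.

Let c := expR (4 * (Jh + Jv)).

Lemma ising_flip v (A : set Omega) : measurable A -> P (flip_spin v @^-1` A) <= c%:E * P A.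
Proof.
move=> mA; pose P' : {measure set Omega -> \bar R} := image_measure P (measurable_flip v).
apply: (@dominated_measurable _ P' P) => //.
- by rewrite expR_ge0.
- by move=> L xi; exact: ising_flip_cyl.
Qed.

Definition xor_config (w : Omega * Omega) : Omega := xor_spin w.

Lemma measurable_xor : measurable_fun setT xor_config.
Proof.
apply: measurable_to_Omega => v.
have m1 : measurable [set w : Omega * Omega | w.1 v].
  by rewrite -[X in measurable X]setTI;
  exact: (@measurable_fst _ _ Omega Omega measurableT _ (measurable_coord v)).
have m2 : measurable [set w : Omega * Omega | w.2 v].
  by rewrite -[X in measurable X]setTI;
  exact: (@measurable_snd _ _ Omega Omega measurableT _ (measurable_coord v)).
rewrite (_ : [set _ | _] = ([set w : Omega * Omega | w.1 v] `&` [set w : Omega * Omega | w.2 v]) `|`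
   (~` [set w : Omega * Omega | w.1 v] `&` ~` [set w : Omega * Omega | w.2 v])).
  by apply: measurableU; apply: measurableI => //; exact: measurableC.
apply/seteqP; split=> w; rewrite /xor_config /xor_spin /=.
  by case: (w.1 v) (w.2 v) => -[]//= _; [left|right].
by case: (w.1 v) (w.2 v) => -[]//= [] [].
Qed.

Definition xor_law : {measure set Omega -> \bar R} := image_measure (P \x P) measurable_xor.

Lemma xor_lawT : xor_law setT = 1.
Proof.
rewrite (_ : xor_law setT = (P \x P) (setT `*` setT)); last first.
  by rewrite setXTT /xor_law image_measureE preimage_setT.
rewrite product_measure1E// -[RHS]mule1; congr (_ * _); exact: probability_setT.
Qed.

(** Flipping an XOR spin amounts to flipping that spin in the second copy with the first copy
    frozen. On each section this is [ising_flip], and integration over the first copy keeps the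
    constant. *)
Lemma xor_law_flip v (A : set Omega) : measurable A ->
  xor_law (flip_spin v @^-1` A) <= c%:E * xor_law A.
Proof.
move=> mA; rewrite !image_measureE /product_measure1.
have mE : measurable (xor_config @^-1` A) by rewrite -[X in measurable X]setTI; exact: measurable_xor.
have mE' : measurable (xor_config @^-1` (flip_spin v @^-1` A)).
  rewrite -[X in measurable X]setTI; apply: measurable_xor => //.
  by rewrite -[X in measurable X]setTI; exact: measurable_flip.
rewrite -ge0_integralZl//; last by rewrite lee_fin expR_ge0.
  apply: ge0_le_integral => //.
  - exact: measurable_fun_xsection.
  - by apply: measurable_funeM; exact: measurable_fun_xsection.
  - move=> x _.
    have e : xsection (xor_config @^-1` (flip_spin v @^-1` A)) x =
        flip_spin v @^-1` (xsection (xor_config @^-1` A) x); last first.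
      rewrite /comp e; apply: ising_flip; exact: measurable_xsection.
    have h y : xor_config (x, flip_spin v y) = flip_spin v (xor_config (x, y)).
      apply/funext => z; rewrite /flip_spin /xor_config /xor_spin /=.
      by case: (z =P v) => // _; case: (x z); case: (y z).
    by apply/seteqP; split=> y; rewrite /xsection /= !inE /= h.
exact: measurable_fun_xsection.
Qed.

(** Translation moves both copies: on sections the second copy is handled by [ising_translate],
    which leaves the section at a translated first copy, and a change of variables in the outer
    integral removes that translation. *)
Lemma xor_law_translate (u : vertex) (A : set Omega) : u = (1, 0)%R \/ u = (0, 1)%R -> measurable A ->
  xor_law (translate u @^-1` A) = xor_law A.
Proof.
move=> hu mA; rewrite !image_measureE /product_measure1.
have mE : measurable (xor_config @^-1` A) by rewrite -[X in measurable X]setTI; exact: measurable_xor.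
pose g x := P (xsection (xor_config @^-1` A) x).
transitivity (\int[P]_(x in translate u @^-1` setT) (g \o translate u) x).
  rewrite preimage_setT; apply: eq_integral => x _.
  have e : xsection (xor_config @^-1` (translate u @^-1` A)) x =
      translate u @^-1` (xsection (xor_config @^-1` A) (translate u x)).
    by apply/seteqP; split=> y; rewrite /xsection /= !inE.
  by rewrite /comp e; apply: ising_translate hu _; exact: measurable_xsection.
rewrite -(ge0_integral_pushforward (measurable_translate u))//; last exact: measurable_fun_xsection.
apply: (eq_measure_integral P (m1 := image_measure P (measurable_translate u))) => B mB _.
exact: ising_translate hu mB.
Qed.
End ising.

(** * Hubs *)

Section connectivity.
Implicit Types (C K : set dual_edge) (e f g k x y : dual_edge).

Lemma share_endpoint_sym e f : share_endpoint e f -> share_endpoint f e.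
Proof. by rewrite /share_endpoint; intuition. Qed.

Lemma share_endpointP (p : int * int) e f :
  (p = (dual_ends e).1 \/ p = (dual_ends e).2) ->
  (p = (dual_ends f).1 \/ p = (dual_ends f).2) -> share_endpoint e f.
Proof.
by rewrite /share_endpoint => -[]-> []->; [left|right; left|right; right; left|right; right; right].
Qed.

Lemma connected_in_refl C e : C e -> connected_in C e e.
Proof. by move=> Ce; split=> //; split=> //; apply: rt_refl. Qed.

Lemma connected_in_step C e f :
  C e -> C f -> share_endpoint e f -> connected_in C e f.
Proof. by move=> Ce Cf ef; split=> //; split=> //; apply: rt_step. Qed.

Lemma connected_in_trans C e f g :
  connected_in C e f -> connected_in C f g -> connected_in C e g.
Proof.
move=> [Ce [_ ef]] [_ [Cg fg]]; split=> //; split=> //.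
exact: (rt_trans _ _ _ f).
Qed.

Lemma connected_in_sym C e f : connected_in C e f -> connected_in C f e.
Proof.
move=> [Ce [Cf ef]]; split=> //; split=> //; elim: ef => {e f Ce Cf}.
- by move=> e f [Ce [Cf ef]]; apply: rt_step; split=> //; split=> //; exact: share_endpoint_sym.
- by move=> e; apply: rt_refl.
- by move=> e f g _ ef _ fg; apply: (rt_trans _ _ _ f).
Qed.

Lemma connected_inL C e f : connected_in C e f -> C e. Proof. by case. Qed.

Lemma connected_inR C e f : connected_in C e f -> C f. Proof. by case=> _ []. Qed.

Lemma connected_in_sub C C' e f :
  C `<=` C' -> connected_in C e f -> connected_in C' e f.
Proof.
move=> CC' [Ce [Cf ef]]; split; first exact: CC'.
split; first exact: CC'.
elim: ef => [g h [Cg [Ch gh]]|g|g h i _ gh _ hi].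
- by apply: rt_step; split; [exact: CC'|split=> //; exact: CC'].
- exact: rt_refl.
- exact: (rt_trans _ _ _ h).
Qed.

Lemma connected_in_ind C e (P : dual_edge -> Prop) :
  P e ->
  (forall f g, connected_in C e f -> P f -> C g -> share_endpoint f g -> P g) ->
  forall f, connected_in C e f -> P f.
Proof.
move=> Pe Pstep f [Ce [Cf /clos_rt_rtn1_iff]].
elim=> // g h [Cg [Ch gh]] /clos_rt_rtn1_iff eg Pg.
by apply: (Pstep g).
Qed.

Lemma first_hit C K e k : ~ K e -> connected_in C e k -> K k ->
  exists f g, [/\ connected_in (C `\` K) e f, C g, K g & share_endpoint f g].
Proof.
move=> Ke ek Kk; have Ce := connected_inL ek.
suff : connected_in (C `\` K) e k \/
    exists f g, [/\ connected_in (C `\` K) e f, C g, K g & share_endpoint f g].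
  by case=> // /connected_inR[_] /(_ Kk).
move: k ek {Kk}; apply: connected_in_ind.
- by left; apply: connected_in_refl.
- move=> f g ef [ef0|] Cg fg; last by right.
  have [Kg|Kg] := pselect (K g); first by right; exists f, g.
  by left; apply: (connected_in_trans ef0); apply: connected_in_step => //; exact: connected_inR ef0.
Qed.

(* Otherwise the contour would be covered by [K] and finitely many finite pieces,
   one for each edge adjacent to [K]. *)
Lemma infinite_branch C K N e : finite_set K -> finite_set N ->
  (forall f g, share_endpoint f g -> K g -> N f) ->
  K e -> infinite_contour_at C e ->
  exists f g, [/\ infinite_contour_at (C `\` K) f, C g, K g, share_endpoint f g
    & connected_in C f e].
Proof.
move=> finK finN KN Ke [Ce infe]; apply: contrapT => nex; apply: infe.
pose M := [set f | N f /\ finite_set (contour_of (C `\` K) f)].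
apply: (@sub_finite_set _ _ (K `|` \bigcup_(f in M) contour_of (C `\` K) f)); last first.
  rewrite finite_setU; split=> //; apply: bigcup_finite; last by move=> f [].
  by apply: sub_finite_set finN => f [].
move=> x /= ex; have [Kx|Kx] := pselect (K x); first by left.
right; have [f [g [xf Cg Kg fg]]] := first_hit Kx (connected_in_sym ex) Ke.
exists f; last exact: connected_in_sym.
split; first exact: KN fg Kg.
apply: contrapT => inff; apply: nex; exists f, g; split=> //.
- by split=> //; exact: connected_inR xf.
- apply: connected_in_trans (connected_in_sym ex).
  by apply: connected_in_sub (connected_in_sym xf) => y [].
Qed.

(** The part of [C] in [K] is nonempty and connected within [K], with [k] as representative.
    Removing a set disjoint from [K] therefore leaves this part in one piece. *)
Definition core C K k := [/\ C k, K k & forall x, C x -> K x -> connected_in (C `&` K) k x].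

(** A thickened trifurcation point of Burton and Keane, with the set [K] in place of a vertex. *)
Definition hub C K := exists k e1 e2 e3,
  [/\ core C K k,
      [/\ infinite_contour_at (C `\` K) e1, infinite_contour_at (C `\` K) e2
        & infinite_contour_at (C `\` K) e3],
      [/\ connected_in C e1 k, connected_in C e2 k & connected_in C e3 k]
    & [/\ ~ connected_in (C `\` K) e1 e2, ~ connected_in (C `\` K) e1 e3
        & ~ connected_in (C `\` K) e2 e3]].

(* The branch of [x] at [K] does not contain [K'], hence survives the removal of [K']. *)
Lemma branch_swap C K K' k k' x : K `&` K' = set0 -> core C K k -> core C K' k' ->
  connected_in C x k -> ~ K x -> ~ connected_in (C `\` K) x k' ->
  connected_in (C `\` K') x k.
Proof.
move=> KK' [Ck Kk corek] [Ck' Kk' corek'] xk Kx xk'.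
have disj y : K y -> ~ K' y by move=> Ky K'y; have : (K `&` K') y by []; rewrite KK'.
(* The part of [C] in [K'] is connected off [K], so meeting it anywhere off [K] already means being
   joined to [k'] off [K]. *)
have avoid y : connected_in (C `\` K) x y -> ~ K' y.
  move=> xy K'y; apply: xk'; apply: (connected_in_trans xy); apply: connected_in_sym.
  have Cy : C y by have [] := connected_inR xy.
  by apply: connected_in_sub (corek' _ Cy K'y) => z [Cz K'z]; split=> // /disj.
have [f [g [xf Cg Kg fg]]] := first_hit Kx xk Kk.
have xf' : connected_in (C `\` K') x f.
  move: f xf {fg}; apply: connected_in_ind.
    apply: connected_in_refl; split; first exact: connected_inL xk.
    by apply: avoid; apply: connected_in_refl; split=> //; exact: connected_inL xk.
  move=> f h xf xf' Ch fh; apply: (connected_in_trans xf').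
  apply: (connected_in_step _ _ fh); first exact: connected_inR xf'.
  split; first by case: Ch.
  apply: avoid; apply: (connected_in_trans xf); apply: (connected_in_step _ _ fh) => //.
  exact: connected_inR xf.
apply: (connected_in_trans xf'); apply: (@connected_in_trans _ _ g).
  by apply: (connected_in_step _ _ fg); [exact: connected_inR xf'|split=> //; exact: disj].
apply: connected_in_sym; apply: connected_in_sub (corek _ Cg Kg) => z [Cz Kz].
by split=> //; exact: disj.
Qed.

(* The index [n] determines the hub: see [late_branch_inj]. *)
Definition late_branch C K (Y : seq dual_edge) k n :=
  exists y y1 y2,
  [/\ core C K k,
      [/\ y \in Y, index y Y = n, (index y1 Y < n)%N & (index y2 Y < n)%N],
      [/\ connected_in C y k, connected_in C y1 k & connected_in C y2 k]
    & [/\ ~ K y, ~ K y1, ~ K y2, ~ connected_in (C `\` K) y1 y2 &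
      forall z : dual_edge, (index z Y < n)%N -> ~ connected_in (C `\` K) y z]].

(** Suppose two disjoint hubs share the exit [y]. By [branch_swap], [y] is joined to the core of one
    of them, [A], off the other, [B]. Now [A] has two further branches with earlier exits, and [B]
    lies in at most one of these. The other one avoids [B], so its exit is joined through the core
    of [A] to [y] off [B], which contradicts that [y] is the first exit of its branch at [B]. *)
Lemma late_branch_inj C K K' Y k k' n : K `&` K' = set0 ->
  late_branch C K Y k n -> late_branch C K' Y k' n -> False.
Proof.
move=> KK' [y [y1 [y2 [ck [yY yn y1n y2n] [yk y1k y2k] [Ky Ky1 Ky2 y12 ymin]]]]].
move=> [y' [z1 [z2 [ck' [y'Y y'n z1n z2n] [y'k z1k z2k] [Ky' Kz1 Kz2 z12 zmin]]]]].
have yy' : y' = y by rewrite -(nth_index y yY) -(nth_index y y'Y) yn y'n.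
subst y'.
have K'K : K' `&` K = set0 by rewrite setIC.
suff main : forall A B a b t1 t2, A `&` B = set0 -> core C A a -> core C B b ->
    ~ A t1 -> ~ A t2 -> (index t1 Y < n)%N -> (index t2 Y < n)%N ->
    connected_in C t1 a -> connected_in C t2 a -> ~ connected_in (C `\` A) t1 t2 ->
    connected_in (C `\` B) y a ->
    exists2 t, (index t Y < n)%N & connected_in (C `\` B) y t.
  have [ya|ya] := pselect (connected_in (C `\` K') y k).
    by have [t /zmin] := main K K' k k' y1 y2 KK' ck ck' Ky1 Ky2 y1n y2n y1k y2k y12 ya.
  have yb := branch_swap K'K ck' ck y'k Ky' ya.
  by have [t /ymin] := main K' K k' k z1 z2 K'K ck' ck Kz1 Kz2 z1n z2n z1k z2k z12 yb.
move=> A B a b t1 t2 AB ca cb At1 At2 t1n t2n t1a t2a t12 ya.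
have [t1b|t1b] := pselect (connected_in (C `\` A) t1 b).
  exists t2 => //; apply: (connected_in_trans ya); apply: connected_in_sym.
  apply: branch_swap AB ca cb t2a At2 _ => t2b; apply: t12.
  exact: connected_in_trans t1b (connected_in_sym t2b).
exists t1 => //; apply: (connected_in_trans ya); apply: connected_in_sym.
exact: branch_swap AB ca cb t1a At1 t1b.
Qed.

Lemma first_in_branch C e (Y : seq dual_edge) :
  (exists2 y, y \in Y & connected_in C e y) ->
  exists y, [/\ y \in Y, connected_in C e y &
    forall z, (index z Y < index y Y)%N -> ~ connected_in C y z].
Proof.
move=> [y0 y0Y ey0].
pose A n := `[< exists y, [/\ y \in Y, index y Y = n & connected_in C e y] >].
have exA : exists n, A n by exists (index y0 Y); apply/asboolP; exists y0.
have := ex_minnP exA => -[n /asboolP[y [yY <- ey]] nmin].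
(* An edge outside [Y] has index [size Y], so only members of [Y] can precede [y]. *)
exists y; split=> // z zy yz; have : A (index z Y).
  apply/asboolP; exists z; split=> //; last exact: connected_in_trans yz.
  by rewrite -index_mem (leq_trans zy)// ltnW// index_mem.
by move/nmin; rewrite leqNgt zy.
Qed.

(** Each of the three branches has a first exit in the order of [Y]. The latest of the three becomes
    the exit of the hub, and the two earlier ones are the witnesses [y1] and [y2] on which
    [late_branch_inj] relies. *)
Lemma hub_late C K Y : hub C K ->
  (forall e, infinite_contour_at (C `\` K) e -> (exists2 k, K k & connected_in C e k) ->
     exists2 y, y \in Y & connected_in (C `\` K) e y) ->
  exists k n, (n < size Y)%N /\ late_branch C K Y k n.
Proof.
move=> [k [e1 [e2 [e3 [ck [i1 i2 i3] [c1 c2 c3] [n12 n13 n23]]]]]] hY.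
have Kk : K k by case: ck.
have sel e : infinite_contour_at (C `\` K) e -> connected_in C e k ->
    exists y, [/\ [/\ y \in Y, ~ K y & connected_in C y k], connected_in (C `\` K) e y &
    forall z, (index z Y < index y Y)%N -> ~ connected_in (C `\` K) y z].
  move=> ie ck'; have [y [yY ey ymin]] := first_in_branch (hY e ie (ex_intro2 _ _ k Kk ck')).
  exists y; split=> //; split=> //; first by case: (connected_inR ey).
  by apply: connected_in_trans ck'; apply: connected_in_sub (connected_in_sym ey) => ? [].
have [y1 [[y1Y Ky1 y1k] ey1 y1min]] := sel _ i1 c1.
have [y2 [[y2Y Ky2 y2k] ey2 y2min]] := sel _ i2 c2.
have [y3 [[y3Y Ky3 y3k] ey3 y3min]] := sel _ i3 c3.
have m12 : ~ connected_in (C `\` K) y1 y2.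
  by move=> h; apply: n12; apply: connected_in_trans (connected_in_trans ey1 h) (connected_in_sym ey2).
have m13 : ~ connected_in (C `\` K) y1 y3.
  by move=> h; apply: n13; apply: connected_in_trans (connected_in_trans ey1 h) (connected_in_sym ey3).
have m23 : ~ connected_in (C `\` K) y2 y3.
  by move=> h; apply: n23; apply: connected_in_trans (connected_in_trans ey2 h) (connected_in_sym ey3).
have neq a b : a \in Y -> connected_in C a k -> ~ K a -> ~ connected_in (C `\` K) a b ->
    index a Y <> index b Y.
  move=> aY ak Ka ab iab; apply: ab.
  have bY : b \in Y by rewrite -index_mem -iab index_mem.
  have -> : b = a by rewrite -(nth_index b bY) -iab nth_index.
  by apply: connected_in_refl; split=> //; exact: connected_inL ak.
have d12 := neq _ _ y1Y y1k Ky1 m12; have d13 := neq _ _ y1Y y1k Ky1 m13.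
have d23 := neq _ _ y2Y y2k Ky2 m23.
have := m12; have := m13; have := m23.
have C' : forall a b, ~ connected_in (C `\` K) a b -> ~ connected_in (C `\` K) b a.
  by move=> a b ab /connected_in_sym.
move=> /C' m32 /C' m31 /C' m21; exists k.
have [L3|L3] := boolP ((index y1 Y < index y3 Y)%N && (index y2 Y < index y3 Y)%N).
  move/andP: L3 => [? ?].
  by exists (index y3 Y); rewrite index_mem; split=> //; exists y3, y1, y2.
have [L2|L2] := boolP ((index y1 Y < index y2 Y)%N && (index y3 Y < index y2 Y)%N).
  move/andP: L2 => [? ?].
  by exists (index y2 Y); rewrite index_mem; split=> //; exists y2, y1, y3.
have [? ?] : (index y2 Y < index y1 Y)%N /\ (index y3 Y < index y1 Y)%N by lia.
by exists (index y1 Y); rewrite index_mem; split=> //; exists y1, y2, y3.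
Qed.

(** A hub is sent to the position in [Y] of its late branch, and [late_branch_inj] makes this map
    injective. The index function is total, with the dummy value 0 off the hubs. *)
Lemma hub_count C (I : finType) (K : I -> set dual_edge) (Y : seq dual_edge) :
  (forall i j, i != j -> K i `&` K j = set0) ->
  (forall i e, infinite_contour_at (C `\` K i) e ->
     (exists2 k, K i k & connected_in C e k) ->
     exists2 y, y \in Y & connected_in (C `\` K i) e y) ->
  (#|[set i | `[< hub C (K i) >]]%SET| <= size Y)%N.
Proof.
move=> disj hY.
have sel i : exists n, hub C (K i) ->
    (n < size Y)%N /\ exists k, late_branch C (K i) Y k n.
  have [/hub_late /(_ (hY i))[k [n [nY kn]]]|h] := pselect (hub C (K i)).
    by exists n => _; split=> //; exists k.
  by exists 0%N => /h.
have [phi phiP] := choice sel.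
rewrite cardE -(size_map phi) -(size_iota 0 (size Y)); apply: uniq_leq_size.
  rewrite map_inj_in_uniq ?enum_uniq// => i j; rewrite !mem_enum !inE.
  move=> hi hj ij; have [_ [k ki]] := phiP i hi; have [_ [l lj]] := phiP j hj.
  apply: contrapT => /eqP/disj dij; apply: (late_branch_inj dij ki).
  by rewrite ij; exact: lj.
move=> n /mapP[i]; rewrite mem_enum inE => hi ->.
by rewrite mem_iota; have [] := phiP i (asboolW hi).
Qed.
End connectivity.

(** * Merging the contours that meet a square *)

Definition in_square (m : nat) (p : int * int) :=
  [&& - m%:Z <= p.1, p.1 <= m%:Z, - m%:Z <= p.2 & p.2 <= m%:Z].

Definition touching (m : nat) : set dual_edge :=
  [set e | in_square m (dual_ends e).1 || in_square m (dual_ends e).2].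

(** The asymmetric bounds come from the half-integer shift: these are the sites enclosed by the
    boundary of the square of dual vertices with coordinates from [-m] to [m]. *)
Definition inner_face (m : nat) (v : vertex) :=
  [&& - m%:Z < v.1, v.1 <= m%:Z, - m%:Z < v.2 & v.2 <= m%:Z].

(** Consequently rewriting the spins of inner faces can change only those dual edges that have both
    ends in the square, fewer than the edges of [touching m]. *)
Lemma crossed_outer m e : ~~ (in_square m (dual_ends e).1 && in_square m (dual_ends e).2) ->
  ~~ inner_face m (crossed e).1 /\ ~~ inner_face m (crossed e).2.
Proof. by case: e => -[a b] []; rewrite /in_square /inner_face /=; lia. Qed.

Lemma contour_outer m (s s' : vertex -> bool) e :
  (forall v, ~~ inner_face m v -> s' v = s v) ->
  ~~ (in_square m (dual_ends e).1 && in_square m (dual_ends e).2) ->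
  contour_config s' e <-> contour_config s e.
Proof. by move=> ss' /crossed_outer[h1 h2]; rewrite /contour_config /= !ss'. Qed.

Lemma int_interval_stable (P : int -> Prop) (lo hi : int) :
  (forall a, lo <= a -> a < hi -> P a <-> P (a + 1)) ->
  forall a b, lo <= a <= hi -> lo <= b <= hi -> P a -> P b.
Proof.
move=> PS; suff up : forall n a, lo <= a -> a + n%:Z <= hi -> P a <-> P (a + n%:Z).
  move=> a b /andP[la ah] /andP[lb bh] Pa; have [ab|ba] := leP a b.
    have [n nE] : exists n : nat, b = a + n%:Z by exists `|b - a|%N; lia.
    by rewrite nE; apply: (iffLR (up n a la _)) => //; lia.
  have [n nE] : exists n : nat, a = b + n%:Z by exists `|a - b|%N; lia.
  by apply: (iffRL (up n b lb _)); rewrite -?nE.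
elim=> [|n IH] a la ah; first by rewrite addr0.
rewrite IH//; last by lia.
by rewrite PS; [have -> : a + n%:Z + 1 = a + n.+1%:Z by lia|lia|lia].
Qed.

Lemma odd_absz1 (z : int) : odd (absz (z + 1)%R) = ~~ odd (absz z).
Proof. lia. Qed.

Lemma contourV s (a b : int) :
  contour_config s ((a, b), true) <-> s (a, b + 1) != s (a + 1, b + 1).
Proof. by []. Qed.

Lemma contourH s (a b : int) :
  contour_config s ((a, b), false) <-> s (a + 1, b) != s (a + 1, b + 1).
Proof. by []. Qed.

Section merged.
Variables (s : vertex -> bool) (m : nat).
Hypothesis m2 : (2 <= m)%N.

Let corner (x : int) : int := if x <= 0 then 1 - m%:Z else m%:Z.
Let beyond (x : int) : int := if x <= 0 then - m%:Z else m%:Z + 1.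

(* The phase of the chessboard in each quadrant makes the corner face disagree with
   its horizontal neighbour outside the square. *)
Definition merged (v : vertex) : bool :=
  if inner_face m v then
    ~~ s (beyond v.1, corner v.2) (+) odd (absz (v.1 + v.2 - corner v.1 - corner v.2)%R)
  else s v.

Let C := contour_config merged.
Let J := C `&` touching m.
Let e0 : dual_edge := ((1, 1), false).

(** For [b != 0] the two faces separated by the edge lie in the same quadrant, where chessboard
    neighbours disagree. Across row 0 two unrelated phases meet, and nothing is forced. *)
Lemma merged_row (a b : int) : - m%:Z <= a < m%:Z -> - m%:Z < b < m%:Z -> b != 0 ->
  J ((a, b), false).
Proof.
move=> am bm b0; split; last by rewrite /touching /in_square /=; lia.
apply/contourH; rewrite /merged !ifT; [|by rewrite /inner_face /=; lia..] => /=.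
have -> : corner (b + 1) = corner b.
  by rewrite /corner; have -> : (b + 1 <= 0) = (b <= 0) by lia.
have -> : a + 1 + (b + 1) - corner (a + 1) - corner b = (a + 1 + b - corner (a + 1) - corner b) + 1 by lia.
by rewrite odd_absz1; case: (s _); case: (odd _).
Qed.

Lemma merged_col (a b : int) : - m%:Z < a < m%:Z -> - m%:Z <= b < m%:Z -> a != 0 ->
  J ((a, b), true).
Proof.
move=> am bm b0; split; last by rewrite /touching /in_square /=; lia.
apply/contourV; rewrite /merged !ifT; [|by rewrite /inner_face /=; lia..] => /=.
have a1 : (a + 1 <= 0) = (a <= 0) by lia.
have -> : corner (a + 1) = corner a by rewrite /corner a1.
have -> : beyond (a + 1) = beyond a by rewrite /beyond a1.
have -> : a + 1 + (b + 1) - corner a - corner (b + 1) = (a + (b + 1) - corner a - corner (b + 1)) + 1 by lia.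
by rewrite odd_absz1; case: (s _); case: (odd _).
Qed.

Let good (p : int * int) := exists e, connected_in J e0 e /\
  (p = (dual_ends e).1 \/ p = (dual_ends e).2).

Let good_edge e p : J e -> good p -> (p = (dual_ends e).1 \/ p = (dual_ends e).2) ->
  connected_in J e0 e.
Proof.
move=> Je [f [e0f pf]] pe; apply: (connected_in_trans e0f).
by apply: connected_in_step => //; [exact: connected_inR e0f|exact: share_endpointP pf pe].
Qed.

Let good_edge_ends e : J e -> good (dual_ends e).1 <-> good (dual_ends e).2.
Proof.
move=> Je; split=> g.
  by exists e; split; [apply: (good_edge Je g); left|right].
by exists e; split; [apply: (good_edge Je g); right|left].
Qed.

Let good_row (b a a' : int) : - m%:Z < b < m%:Z -> b != 0 ->
  - m%:Z <= a <= m%:Z -> - m%:Z <= a' <= m%:Z -> good (a, b) -> good (a', b).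
Proof.
move=> bm b0; apply: (@int_interval_stable (fun a => good (a, b))) => {}a la am.
by apply: (@good_edge_ends ((a, b), false)); apply: merged_row => //; lia.
Qed.

Let good_col (a b b' : int) : - m%:Z < a < m%:Z -> a != 0 ->
  - m%:Z <= b <= m%:Z -> - m%:Z <= b' <= m%:Z -> good (a, b) -> good (a, b').
Proof.
move=> bm b0; apply: (@int_interval_stable (fun b => good (a, b))) => {}b la am.
by apply: (@good_edge_ends ((a, b), true)); apply: merged_col => //; lia.
Qed.

(** The dual vertices on a row or column of forced edges. The square has nine other points, those
    with both coordinates among [-m], 0 and [m]: the centre, the corners and the midpoints of the
    sides. For [m >= 2] no two of the nine are adjacent. *)
Let spine (p : int * int) := in_square m p &&
  ([&& - m%:Z < p.1, p.1 < m%:Z & p.1 != 0] || [&& - m%:Z < p.2, p.2 < m%:Z & p.2 != 0]).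

Let spine_good p : spine p -> good p.
Proof.
case: p => a b; rewrite /spine /in_square /= => ab.
have g11 : good (1, 1).
  exists e0; split; last by left.
  by apply: connected_in_refl; apply: merged_row; lia.
have [/and3P[a1 a2 a0]|h] := boolP [&& - m%:Z < a, a < m%:Z & a != 0].
  apply: (@good_col _ 1); [lia|lia|lia|lia|].
  by apply: (@good_row _ 1); lia || exact: g11.
apply: (@good_row _ 1); [lia|lia|lia|lia|].
by apply: (@good_col _ 1); lia || exact: g11.
Qed.

(** An edge inside the square has an end on the spine because the nine exceptional points are
    pairwise non-adjacent. What remains are edges that leave the square. *)
Let spine_or_outside e : J e ->
  [\/ spine (dual_ends e).1, spine (dual_ends e).2,
      in_square m (dual_ends e).1 /\ ~~ in_square m (dual_ends e).2 |
      in_square m (dual_ends e).2 /\ ~~ in_square m (dual_ends e).1].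
Proof.
case: e => -[a b] [] [_]; rewrite /touching /spine /in_square /= => h.
- have [|] := boolP (in_square m (a, b)); have [|] := boolP (in_square m (a, b + 1));
  rewrite /in_square /= => h1 h2.
  + have [h3|h3] := boolP (([&& - m%:Z < a, a < m%:Z & a != 0] || [&& - m%:Z < b, b < m%:Z & b != 0])).
      by constructor 1; lia.
    by constructor 2; lia.
  + by constructor 3; lia.
  + by constructor 4; lia.
  + by lia.
- have [|] := boolP (in_square m (a, b)); have [|] := boolP (in_square m (a + 1, b));
  rewrite /in_square /= => h1 h2.
  + have [h3|h3] := boolP (([&& - m%:Z < a, a < m%:Z & a != 0] || [&& - m%:Z < b, b < m%:Z & b != 0])).
      by constructor 1; lia.
    by constructor 2; lia.
  + by constructor 3; lia.
  + by constructor 4; lia.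
  + by lia.
Qed.

Let incident (a b : int) : seq dual_edge :=
  [:: ((a, b), true); ((a, b - 1), true); ((a, b), false); ((a - 1, b), false)].

Let incidentP e a b : e \in incident a b <-> ((a, b) = (dual_ends e).1 \/ (a, b) = (dual_ends e).2).
Proof.
case: e => -[c d] r; rewrite !inE !xpair_eqE /=; case: r => /=; split.
- by case/or4P=> /andP[/andP[/eqP -> /eqP ->]]// _; [left|right; rewrite subrK].
- by case=> -[-> ->]; rewrite ?addrK !eqxx ?orbT.
- by case/or4P=> /andP[/andP[/eqP -> /eqP ->]]// _; [left|right; rewrite subrK].
- by case=> -[-> ->]; rewrite ?addrK !eqxx ?orbT.
Qed.

(* Around a dual vertex an even number of edges is present. *)
Let parity (a b : int) e : e \in incident a b -> C e ->
  exists f, [/\ f \in incident a b, f != e & C f].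
Proof.
have up : C ((a, b), true) <-> merged (a, b + 1) != merged (a + 1, b + 1) by [].
have right : C ((a, b), false) <-> merged (a + 1, b) != merged (a + 1, b + 1) by [].
have down : C ((a, b - 1), true) <-> merged (a, b) != merged (a + 1, b).
  by rewrite /C contourV subrK.
have left : C ((a - 1, b), false) <-> merged (a, b) != merged (a, b + 1).
  by rewrite /C contourH subrK.
move=> eI Ce; apply: contrapT => no.
have nC f : f \in incident a b -> f == e \/ ~ C f.
  move=> fI; have [|fe] := eqVneq f e; first by left.
  by right=> Cf; apply: no; exists f.
have not_up : ((a, b), true) == e \/ merged (a, b + 1) = merged (a + 1, b + 1).
  have [|u] := nC ((a, b), true) ltac:(by rewrite !inE eqxx); first by left.
  by right; apply/eqP/negPn/negP => /up.
have not_down : ((a, b - 1), true) == e \/ merged (a, b) = merged (a + 1, b).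
  have [|u] := nC ((a, b - 1), true) ltac:(by rewrite !inE eqxx orbT); first by left.
  by right; apply/eqP/negPn/negP => /down.
have not_right : ((a, b), false) == e \/ merged (a + 1, b) = merged (a + 1, b + 1).
  have [|u] := nC ((a, b), false) ltac:(by rewrite !inE eqxx !orbT); first by left.
  by right; apply/eqP/negPn/negP => /right.
have not_left : ((a - 1, b), false) == e \/ merged (a, b) = merged (a, b + 1).
  have [|u] := nC ((a - 1, b), false) ltac:(by rewrite !inE eqxx !orbT); first by left.
  by right; apply/eqP/negPn/negP => /left.
move: eI; rewrite !inE => /or4P[] /eqP eE; rewrite {}eE in Ce not_up not_down not_right not_left.
- case: not_down => [|h1]; first by rewrite !xpair_eqE; lia.
  case: not_right => [|h2]; first by rewrite !xpair_eqE; lia.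
  case: not_left => [|h3]; first by rewrite !xpair_eqE; lia.
  by move/up: Ce; rewrite -h2 -h1 -h3 eqxx.
- case: not_up => [|h1]; first by rewrite !xpair_eqE; lia.
  case: not_right => [|h2]; first by rewrite !xpair_eqE; lia.
  case: not_left => [|h3]; first by rewrite !xpair_eqE; lia.
  by move/down: Ce; rewrite h3 h1 h2 eqxx.
- case: not_down => [|h1]; first by rewrite !xpair_eqE; lia.
  case: not_up => [|h2]; first by rewrite !xpair_eqE; lia.
  case: not_left => [|h3]; first by rewrite !xpair_eqE; lia.
  by move/right: Ce; rewrite -h2 -h1 -h3 eqxx.
- case: not_down => [|h1]; first by rewrite !xpair_eqE; lia.
  case: not_right => [|h2]; first by rewrite !xpair_eqE; lia.
  case: not_up => [|h3]; first by rewrite !xpair_eqE; lia.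
  by move/left: Ce; rewrite h3 h1 h2 eqxx.
Qed.

Let incident_good (a b : int) e f : e \in incident a b -> J e -> f \in incident a b -> C f ->
  spine (dual_ends f).1 || spine (dual_ends f).2 -> connected_in J e0 e.
Proof.
move=> /incidentP ae Je /incidentP af Cf sf.
have Jf : J f.
  by split=> //; rewrite /touching /=; case/orP: sf => /andP[-> _]; rewrite ?orbT.
apply: (good_edge Je _ ae); exists f; split=> //.
by case/orP: sf => /spine_good g; apply: (good_edge Jf g); [left|right].
Qed.

(** Two edges leave the square at a corner, and parity might only pair them with each other. Here
    the phase enters: the corner face disagrees with its horizontal neighbour outside, and the
    vertical edge between the two leads from the corner to the spine. *)
Let merged_corner (a b : int) : (a == m%:Z) || (a == - m%:Z) -> (b == m%:Z) || (b == - m%:Z) ->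
  exists f, [/\ f \in incident a b, C f & spine (dual_ends f).1 || spine (dual_ends f).2].
Proof.
move=> am bm; have [bE|bE] := boolP (b == m%:Z).
  exists ((a, b - 1), true); split.
  - by rewrite !inE eqxx orbT.
  - rewrite /C contourV subrK; move: am bE => /orP[]/eqP -> /eqP ->.
      rewrite /merged ifT; last by rewrite /inner_face /=; lia.
      rewrite ifF; last by rewrite /inner_face /=; lia.
      have mn : (m%:Z <= 0) = false by lia.
      rewrite /corner /beyond /= mn.
      have -> : m%:Z + m%:Z - m%:Z - m%:Z = 0 by lia.
      by rewrite /=; case: (s _).
    rewrite /merged ifF; last by rewrite /inner_face /=; lia.
    rewrite ifT; last by rewrite /inner_face /=; lia.
    have mn : (m%:Z <= 0) = false by lia.
    have mn' : (- m%:Z + 1 <= 0) by lia.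
    rewrite /corner /beyond /= mn mn'.
    have -> : - m%:Z + 1 + m%:Z - (1 - m%:Z) - m%:Z = 0 by lia.
    by rewrite /=; case: (s _).
  - by rewrite /spine /in_square /=; lia.
exists ((a, b), true); have {}bE : b = - m%:Z by lia.
split.
- by rewrite !inE eqxx.
- rewrite /C contourV bE; move: am => /orP[]/eqP ->.
    rewrite /merged ifT; last by rewrite /inner_face /=; lia.
    rewrite ifF; last by rewrite /inner_face /=; lia.
    have mn : (m%:Z <= 0) = false by lia.
    have mn' : (- m%:Z + 1 <= 0) by lia.
    rewrite /corner /beyond /= mn mn' [1 - _]addrC.
    have -> : m%:Z + (- m%:Z + 1) - m%:Z - (- m%:Z + 1) = 0 by lia.
    by rewrite /=; case: (s _).
  rewrite /merged ifF; last by rewrite /inner_face /=; lia.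
  rewrite ifT; last by rewrite /inner_face /=; lia.
  have mn' : (- m%:Z + 1 <= 0) by lia.
  rewrite /corner /beyond /= mn' [1 - _]addrC.
  have -> : (- m%:Z + 1) + (- m%:Z + 1) - (- m%:Z + 1) - (- m%:Z + 1) = 0 by lia.
  by rewrite /=; case: (s _).
- by rewrite /spine /in_square /=; lia.
Qed.

(** At the midpoint of a side only one edge leaves the square, so the second edge supplied by
    [parity] stays inside and ends on the spine. Corners are left to [merged_corner], and no edge at
    the centre leaves the square. *)
Let merged_boundary (a b : int) e : e \in incident a b -> C e -> in_square m (a, b) ->
  ~~ (in_square m (dual_ends e).1 && in_square m (dual_ends e).2) -> ~~ spine (a, b) ->
  exists f, [/\ f \in incident a b, C f & spine (dual_ends f).1 || spine (dual_ends f).2].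
Proof.
move=> eI Ce abm eout nsp.
have [/andP[]|h] := boolP (((a == m%:Z) || (a == - m%:Z)) && ((b == m%:Z) || (b == - m%:Z))).
  exact: merged_corner.
have [f [fI fe Cf]] := parity eI Ce; exists f; split=> //.
move: eI fI fe eout nsp h abm; rewrite !inE => /or4P[]/eqP -> /or4P[]/eqP -> ;
  rewrite ?eqxx // /spine /in_square /=; lia.
Qed.

Lemma merged_connected e f : J e -> J f -> connected_in J e f.
Proof.
suff base g : J g -> connected_in J e0 g.
  by move=> /base/connected_in_sym h /base; exact: connected_in_trans.
move=> Jg; have [Cg _] := Jg.
have bd a b : (a, b) = (dual_ends g).1 \/ (a, b) = (dual_ends g).2 -> in_square m (a, b) ->
    ~~ (in_square m (dual_ends g).1 && in_square m (dual_ends g).2) -> connected_in J e0 g.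
  move=> /incidentP gI abm gout; have [/spine_good sp|nsp] := boolP (spine (a, b)).
    by apply: (good_edge Jg sp); exact/incidentP.
  have [h [hI Ch hs]] := merged_boundary gI Cg abm gout nsp.
  exact: (incident_good gI Jg hI Ch hs).
have [sp|sp|[g1 g2]|[g2 g1]] := spine_or_outside Jg.
- by apply: (good_edge Jg (spine_good sp)); left.
- by apply: (good_edge Jg (spine_good sp)); right.
- by apply: (bd (dual_ends g).1.1 (dual_ends g).1.2);
  rewrite -?surjective_pairing ?g1 ?(negbTE g2) //; left.
- by apply: (bd (dual_ends g).2.1 (dual_ends g).2.2);
  rewrite -?surjective_pairing ?g2 ?(negbTE g1) //; right.
Qed.

Lemma merged_outer v : ~~ inner_face m v -> merged v = s v.
Proof. by rewrite /merged => /negbTE ->. Qed.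
End merged.

(** * Translations of contours, boxes and their frames *)

Section geometry.
Implicit Types (C K : set dual_edge) (e f g k x y : dual_edge).

Definition shift_edge (u : int * int) (e : dual_edge) : dual_edge := (e.1 + u, e.2).

Lemma shift_edgeK u : cancel (shift_edge u) (shift_edge (- u)).
Proof. by move=> [p d]; rewrite /shift_edge /= addrK. Qed.

Lemma shift_edgeNK u : cancel (shift_edge (- u)) (shift_edge u).
Proof. by move=> [p d]; rewrite /shift_edge /= subrK. Qed.

Lemma dual_ends_shift u e :
  dual_ends (shift_edge u e) = ((dual_ends e).1 + u, (dual_ends e).2 + u).
Proof.
by case: e u => -[a b] [] [c d]; congr (_, _); congr (_, _); rewrite /= addrAC.
Qed.

Lemma crossed_shift u e :
  crossed (shift_edge u e) = ((crossed e).1 + u, (crossed e).2 + u).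
Proof.
case: e u => -[a b] [] [c d]; rewrite /crossed /shift_edge /=;
by congr (_, _); congr (_, _); rewrite /= addrAC.
Qed.

Lemma contour_translate u (s : Omega) :
  contour_config (translate u s) = shift_edge u @^-1` contour_config s.
Proof.
by apply/seteqP; split=> e; rewrite /preimage /contour_config /mkset crossed_shift.
Qed.

Lemma share_endpoint_shift u e f :
  share_endpoint (shift_edge u e) (shift_edge u f) <-> share_endpoint e f.
Proof.
rewrite /share_endpoint !dual_ends_shift /=.
split; last by case=> [->|[->|[->|->]]]; tauto.
by case=> [/addIr|[/addIr|[/addIr|/addIr]]]; tauto.
Qed.

Lemma connected_in_shift u C e f :
  connected_in C (shift_edge u e) (shift_edge u f) <->
  connected_in (shift_edge u @^-1` C) e f.
Proof.
suff h v D x y : connected_in (shift_edge v @^-1` D) x y ->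
    connected_in D (shift_edge v x) (shift_edge v y).
  split; last exact: h.
  move=> ef; rewrite -[e](shift_edgeK u) -[f](shift_edgeK u); apply: h.
  rewrite (_ : _ @^-1` _ = C)//.
  by apply/seteqP; split=> z /=; rewrite shift_edgeNK.
move=> xy; have Dx := connected_inL xy.
move: y xy; apply: connected_in_ind; first exact: connected_in_refl.
move=> f' g' _ xf Dg fg; apply: (connected_in_trans xf).
by apply: connected_in_step => //; [exact: connected_inR xf|exact/share_endpoint_shift].
Qed.

Lemma infinite_contour_shift u C e :
  infinite_contour_at C (shift_edge u e) <-> infinite_contour_at (shift_edge u @^-1` C) e.
Proof.
suff h v D x : infinite_contour_at (shift_edge v @^-1` D) x ->
    infinite_contour_at D (shift_edge v x).
  split; last exact: h.
  move=> ie; rewrite -[e](shift_edgeK u); apply: h.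
  rewrite (_ : _ @^-1` _ = C)//.
  by apply/seteqP; split=> z /=; rewrite shift_edgeNK.
move=> [Dx infx]; split=> // fin; apply: infx.
apply: sub_finite_set (finite_image (shift_edge (- v)) fin) => y xy.
by exists (shift_edge v y); [exact/connected_in_shift|rewrite shift_edgeK].
Qed.

Lemma hub_shift u C K : hub (shift_edge u @^-1` C) K -> hub C (shift_edge (- u) @^-1` K).
Proof.
have sE D : shift_edge u @^-1` (D `\` shift_edge (- u) @^-1` K) = (shift_edge u @^-1` D) `\` K.
  by apply/seteqP; split=> z [] /=; rewrite shift_edgeK; split.
have sI D : shift_edge u @^-1` (D `&` shift_edge (- u) @^-1` K) = (shift_edge u @^-1` D) `&` K.
  by apply/seteqP; split=> z [] /=; rewrite shift_edgeK; split.
move=> [k [e1 [e2 [e3 [[Ck Kk ck] [i1 i2 i3] [c1 c2 c3] [n1 n2 n3]]]]]].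
exists (shift_edge u k), (shift_edge u e1), (shift_edge u e2), (shift_edge u e3).
split.
- split=> //=; first by rewrite shift_edgeK.
  move=> x Cx Kx; rewrite -[x](shift_edgeNK u); apply/connected_in_shift.
  by rewrite sI; apply: ck => //=; rewrite shift_edgeNK.
- by split; apply/infinite_contour_shift; rewrite sE.
- by split; apply/connected_in_shift.
- by split=> /connected_in_shift; rewrite sE.
Qed.

(** An edge is located by its base point alone. Edges touching the square of radius [m] can start at
    [-m - 1], which is where the asymmetric boxes come from. *)
Definition in_box (lo hi : int) : set dual_edge :=
  [set e | [&& lo <= e.1.1, e.1.1 <= hi, lo <= e.1.2 & e.1.2 <= hi]].

Lemma finite_in_box lo hi : finite_set (in_box lo hi).
Proof.
pose F (x : 'I_(absz (hi - lo)%R).+1 * 'I_(absz (hi - lo)%R).+1 * bool) : dual_edge :=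
  ((lo + (x.1.1 : nat)%:Z, lo + (x.1.2 : nat)%:Z), x.2).
apply: sub_finite_set (finite_seq (codom F)) => -[[a b] d]; rewrite /in_box /= => h.
apply/codomP.
have ha : (absz (a - lo)%R < (absz (hi - lo)%R).+1)%N by lia.
have hb : (absz (b - lo)%R < (absz (hi - lo)%R).+1)%N by lia.
exists ((Ordinal ha, Ordinal hb), d); rewrite /F /=; congr ((_, _), _); lia.
Qed.

Lemma share_base e f : share_endpoint e f ->
  (absz (e.1.1 - f.1.1)%R <= 1)%N && (absz (e.1.2 - f.1.2)%R <= 1)%N.
Proof.
case: e f => -[a b] [] [[c d] []];
by rewrite /share_endpoint /= => -[|[|[|]]] [] *; lia.
Qed.

Lemma share_in_box lo hi e f : share_endpoint e f -> in_box lo hi e ->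
  in_box (lo - 1) (hi + 1) f.
Proof. by move=> /share_base; rewrite /in_box /=; lia. Qed.

Lemma touching_in_box m e : touching m e -> in_box (- m%:Z - 1) m%:Z e.
Proof. by case: e => -[a b] []; rewrite /touching /in_square /in_box /=; lia. Qed.

Lemma touching_le m n e : (m <= n)%N -> touching m e -> touching n e.
Proof. by case: e => -[a b] []; rewrite /touching /in_square /=; lia. Qed.

Lemma touching_exists e : exists m, touching m e.
Proof.
exists (absz e.1.1 + absz e.1.2)%N.
by case: e => -[a b] []; rewrite /touching /in_square /=; lia.
Qed.

(** The base points run over the boundary of the box enlarged by one. Adjacent edges have base
    points at most one apart in each coordinate, so no walk leaves the box without using the frame.
    Corners are repeated; what counts is that the length is linear in the side. *)
Definition frame (lo hi : int) : seq dual_edge :=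
  flatten [seq [:: ((lo - 1, t), d); ((hi + 1, t), d); ((t, lo - 1), d); ((t, hi + 1), d)]
          | t <- [seq lo - 1 + i%:Z | i <- iota 0 (absz (hi - lo)%R + 3)], d <- [:: true; false]].

Lemma size_frame lo hi : size (frame lo hi) = (8 * (absz (hi - lo)%R + 3))%N.
Proof.
rewrite /frame; set s := [seq _ | i <- iota _ _].
have -> : (absz (hi - lo)%R + 3)%N = size s by rewrite size_map size_iota.
by elim: s => //= t s IH; rewrite IH; lia.
Qed.

Lemma mem_frame lo hi e : lo <= hi -> in_box (lo - 1) (hi + 1) e -> ~ in_box lo hi e ->
  e \in frame lo hi.
Proof.
case: e => -[a b] d lohi; rewrite /in_box /= => h1 h2.
have mem t : lo - 1 <= t <= hi + 1 ->
    forall y, y \in [:: ((lo - 1, t), d); ((hi + 1, t), d); ((t, lo - 1), d); ((t, hi + 1), d)] ->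
    y \in frame lo hi.
  move=> ht y yt; apply/flattenP.
  exists [:: ((lo - 1, t), d); ((hi + 1, t), d); ((t, lo - 1), d); ((t, hi + 1), d)] => //.
  apply/allpairsP; exists (t, d); split=> //=; last by case: (d); rewrite !inE.
  by apply/mapP; exists (absz (t - (lo - 1))%R); rewrite ?mem_iota; lia.
have [/orP[] /eqP E|E] := boolP ((a == lo - 1) || (a == hi + 1)).
- by apply: (mem b); rewrite ?E ?inE ?eqxx ?orbT; lia.
- by apply: (mem b); rewrite ?E ?inE ?eqxx ?orbT; lia.
have [/orP[] /eqP E'|E'] := boolP ((b == lo - 1) || (b == hi + 1)).
- by apply: (mem a); rewrite ?E' ?inE ?eqxx ?orbT; lia.
- by apply: (mem a); rewrite ?E' ?inE ?eqxx ?orbT; lia.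
by exfalso; apply: h2; lia.
Qed.

(** The branch contains an edge adjacent to [K], which lies in the box or already on the frame.
    Being infinite, the branch cannot stay in the finite box, and its first edge outside is on the
    frame. *)
Lemma branch_exits C K lo hi e : lo <= hi -> K `<=` in_box lo hi ->
  infinite_contour_at (C `\` K) e -> (exists2 k, K k & connected_in C e k) ->
  exists2 y, y \in frame lo hi & connected_in (C `\` K) e y.
Proof.
move=> lohi KB [[Ce Ke] infe] [k Kk ek].
have [f [g [ef Cg Kg fg]]] := first_hit Ke ek Kk.
have f1 : in_box (lo - 1) (hi + 1) f.
  by apply: share_in_box (share_endpoint_sym fg) _; exact: KB.
have [fB|fB] := pselect (in_box lo hi f); last by exists f => //; exact: mem_frame.
have [x ex xB] : exists2 x, connected_in (C `\` K) e x & ~ in_box lo hi x.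
  apply: contrapT => h; apply: infe; apply: sub_finite_set (finite_in_box lo hi) => x ex.
  by apply: contrapT => xB; apply: h; exists x.
have fx := connected_in_trans (connected_in_sym ef) ex.
have [f' [y [ff' Cy yB fy]]] := @first_hit _ (~` in_box lo hi) _ _ (fun h => h fB) fx xB.
exists y.
  apply: mem_frame => //; apply: share_in_box fy _.
  by have [_ /contrapT] := connected_inR ff'.
apply: (connected_in_trans ef); apply: (@connected_in_trans _ _ f').
  by apply: connected_in_sub ff' => ? [].
by apply: connected_in_step => //; have [] := connected_inR ff'.
Qed.

(** * Infinite contours before and after the merger *)

Section merging.
Variables (s : vertex -> bool) (m : nat).
Hypothesis m2 : (2 <= m)%N.
Let C := contour_config s.
Let C' := contour_config (merged s m).
Let K := touching m.

Let outer_iff e : ~~ (in_square m (dual_ends e).1 && in_square m (dual_ends e).2) ->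
  C' e <-> C e.
Proof. by apply: contour_outer => v; exact: merged_outer. Qed.

Let not_touching e : ~ K e ->
  ~~ in_square m (dual_ends e).1 /\ ~~ in_square m (dual_ends e).2.
Proof. by rewrite /K /touching /mkset => /negP; rewrite negb_or => /andP. Qed.

Let outer_eq : C' `\` K = C `\` K.
Proof.
have h e : ~ K e -> C' e <-> C e.
  by move=> /not_touching[h _]; apply: outer_iff; rewrite negb_and h.
by apply/seteqP; split=> e [Ce Ke]; split=> //; apply/(h e Ke).
Qed.

(** The common endpoint lies outside the square because [f] does not touch it, so [g] is among the
    edges unaffected by the rewriting. Thus the link from a branch to the square survives. *)
Let exit_edge f g : share_endpoint f g -> ~ K f -> C g -> C' g.
Proof.
move=> fg /not_touching[k1 k2] Cg; apply/outer_iff => //; rewrite negb_and.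
by case: fg => [<-|[<-|[<-|<-]]]; rewrite ?k1 ?k2 ?orbT.
Qed.

Let finK : finite_set K.
Proof. by apply: sub_finite_set (finite_in_box _ _) => e; exact: touching_in_box. Qed.

Let branch e : K e -> infinite_contour_at C e ->
  exists f g, [/\ infinite_contour_at (C' `\` K) f, (C' `&` K) g, connected_in C' f g
    & connected_in C f e].
Proof.
move=> Ke ie; have [|f [g [if_ Cg Kg fg fe]]] := @infinite_branch C K
    (in_box (- m%:Z - 1 - 1) (m%:Z + 1)) e finK (finite_in_box _ _) _ Ke ie.
- move=> f g /share_endpoint_sym fg Kg; apply: share_in_box fg _; exact: touching_in_box.
have [[Cf Kf] _] := if_; have C'g := exit_edge fg Kf Cg.
exists f, g; split=> //; first by rewrite outer_eq.
apply: connected_in_step => //.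
have [] : (C' `\` K) f by rewrite outer_eq; split.
by [].
Qed.

Let merged_conn g k : (C' `&` K) g -> (C' `&` K) k -> connected_in C' g k.
Proof. by move=> gJ kJ; apply: connected_in_sub (merged_connected m2 gJ kJ) => ? []. Qed.

(** Each contour leaves an infinite branch off [K] that is still attached to [K], where everything
    present is now connected. The branches stay apart off [K], since there nothing has changed and
    they come from different contours. *)
Lemma merged_hub e1 e2 e3 : K e1 -> K e2 -> K e3 ->
  infinite_contour_at C e1 -> infinite_contour_at C e2 -> infinite_contour_at C e3 ->
  ~ connected_in C e1 e2 -> ~ connected_in C e1 e3 -> ~ connected_in C e2 e3 ->
  hub C' K.
Proof.
move=> K1 K2 K3 i1 i2 i3 n12 n13 n23.
have [f1 [g1 [if1 J1 fg1 fe1]]] := branch K1 i1.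
have [f2 [g2 [if2 J2 fg2 fe2]]] := branch K2 i2.
have [f3 [g3 [if3 J3 fg3 fe3]]] := branch K3 i3.
have sep a b x y : connected_in C x a -> connected_in C y b -> ~ connected_in C a b ->
    ~ connected_in (C' `\` K) x y.
  move=> xa yb ab; rewrite outer_eq => xy; apply: ab.
  apply: (connected_in_trans (connected_in_sym xa)); apply: connected_in_trans yb.
  by apply: connected_in_sub xy => ? [].
exists g1, f1, f2, f3; split.
- by split; [case: J1|case: J1|move=> x Cx Kx; exact: merged_connected].
- by split.
- split=> //; [apply: (connected_in_trans fg2)|apply: (connected_in_trans fg3)];
  exact: merged_conn.
- by split; [exact: sep n12|exact: sep n13|exact: sep n23].
Qed.

(** It suffices that every infinite contour after the merger meets [K]. One that avoided [K] would
    be part of an infinite contour of [C], hence of that of [e1] or [e2], and so would be joined to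
    [K] in [C]; the first edge of [K] on the way survives by [exit_edge], a contradiction. *)
Lemma merged_at_most_one e1 e2 : K e1 -> K e2 ->
  infinite_contour_at C e1 -> infinite_contour_at C e2 -> ~ connected_in C e1 e2 ->
  (forall x, infinite_contour_at C x -> ~ connected_in C e1 x -> ~ connected_in C e2 x -> False) ->
  at_most_one_infinite_contour C'.
Proof.
move=> K1 K2 i1 i2 n12 no3.
suff reach z : infinite_contour_at C' z -> exists2 g, (C' `&` K) g & connected_in C' z g.
  move=> y z /reach[g gJ yg] /reach[h hJ zh].
  apply: (connected_in_trans yg); apply: connected_in_trans (connected_in_sym zh).
  exact: merged_conn.
move=> [C'z infz]; apply: contrapT => nz.
have avoid y : connected_in C' z y -> (C `\` K) y.
  move=> zy; have C'y := connected_inR zy; rewrite -outer_eq; split=> // Ky.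
  by apply: nz; exists y.
have sub y : connected_in C' z y -> connected_in (C `\` K) z y.
  move: y; apply: connected_in_ind.
    by apply: connected_in_refl; apply: avoid; exact: connected_in_refl.
  move=> f g zf zf' Cg fg; apply: (connected_in_trans zf').
  apply: (connected_in_step _ _ fg); first exact: connected_inR zf'.
  apply: avoid; apply: (connected_in_trans zf); apply: (connected_in_step _ Cg fg).
  exact: connected_inR zf.
have [Cz Kz] : (C `\` K) z by apply: avoid; exact: connected_in_refl.
have iz : infinite_contour_at C z.
  split=> // fin; apply: infz; apply: sub_finite_set fin => y zy.
  by apply: connected_in_sub (sub _ zy) => ? [].
have [e Ke ze] : exists2 e, K e & connected_in C z e.
  apply: contrapT => h; apply: (no3 z iz) => /connected_in_sym ez; apply: h.
    by exists e1.
  by exists e2.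
have [f [g [zf Cg Kg fg]]] := first_hit Kz ze Ke.
have [Cf Kf] := connected_inR zf; have C'g := exit_edge fg Kf Cg.
apply: nz; exists g => //; rewrite -outer_eq in zf.
apply: (@connected_in_trans _ _ f); first by apply: connected_in_sub zf => ? [].
by apply: connected_in_step => //; have [] := connected_inR zf.
Qed.
End merging.
End geometry.

(** * Uniqueness of the infinite contour *)

Section measurable_events.
Context d (T : measurableType d).
Implicit Types p q : T -> Prop.

Lemma measurable_and p q : measurable [set t | p t] -> measurable [set t | q t] ->
  measurable [set t | p t /\ q t].
Proof. exact: measurableI. Qed.

Lemma measurable_not p : measurable [set t | p t] -> measurable [set t | ~ p t].
Proof. exact: measurableC. Qed.

Lemma measurable_cst_prop (p : Prop) : measurable [set _ : T | p].
Proof.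
have [hp|hp] := pselect p; first by rewrite (_ : [set _ | _] = setT)//; apply/seteqP; split.
by rewrite (_ : [set _ | _] = set0)//; apply/seteqP; split.
Qed.

Lemma measurable_exists (I : countType) (p : I -> T -> Prop) :
  (forall i, measurable [set t | p i t]) -> measurable [set t | exists i, p i t].
Proof.
move=> mp; rewrite (_ : [set _ | _] = \bigcup_i [set t | p i t]).
  by apply: countable_bigcupT_measurable => //; exact: countableP.
by apply/seteqP; split=> t /= [i]; exists i.
Qed.

Variable C : T -> set dual_edge.
Hypothesis mC : forall e, measurable [set t | C t e].

(** Connectivity by walks of a given length: each length involves only countably many choices of
    edges, so connectivity becomes a countable union of events. *)
Fixpoint reach (A : set dual_edge) (n : nat) (e f : dual_edge) : Prop :=
  if n is n'.+1 then
    exists g, reach A n' e g /\ (A g /\ (A f /\ share_endpoint g f))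
  else e = f.

Lemma connected_in_reach A e f :
  connected_in A e f <-> A e /\ exists n, reach A n e f.
Proof.
split.
  move=> ef; split; first exact: connected_inL ef.
  move: f ef; apply: connected_in_ind; first by exists 0%N.
  move=> f g ef [n nf] Ag fg; exists n.+1, f; split=> //; split=> //.
  exact: connected_inR ef.
move=> [Ae [n]]; elim: n f => [f /= <-|n IH f /= [g [/IH eg [Ag [Af gf]]]]].
  exact: connected_in_refl.
by apply: (connected_in_trans eg); exact: connected_in_step.
Qed.

Lemma measurable_connected e f : measurable [set t | connected_in (C t) e f].
Proof.
rewrite (_ : [set _ | _] = [set t | C t e /\ exists n, reach (C t) n e f]); last first.
  by apply/seteqP; split=> t /= /connected_in_reach.
apply: measurable_and => //; apply: measurable_exists => n.
elim: n f => [|n IH] f /=; first exact: measurable_cst_prop.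
apply: measurable_exists => g; apply: measurable_and => //.
apply: measurable_and => //; apply: measurable_and => //; exact: measurable_cst_prop.
Qed.

Lemma measurable_infinite_contour e : measurable [set t | infinite_contour_at (C t) e].
Proof.
apply: measurable_and => //; apply: measurable_not.
(* A contour is finite when some list of edges covers it, and there are only countably many
   lists. *)
rewrite (_ : [set _ | _] =
    [set t | exists l : seq dual_edge, ~ exists f, ~ f \in l /\ connected_in (C t) e f]).
  apply: measurable_exists => l; apply: measurable_not; apply: measurable_exists => f.
  by apply: measurable_and; [exact: measurable_cst_prop|exact: measurable_connected].
apply/seteqP; split=> t /=.
  move=> /finite_seqP[l lE]; exists l => -[f [fl ef]]; apply: fl.
  by have : [set` l] f by rewrite -lE.
move=> [l hl]; apply: sub_finite_set (finite_seq l) => f ef.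
by apply: contrapT => fl; apply: hl; exists f.
Qed.
End measurable_events.

Lemma measurable_contour e : measurable [set w : Omega | contour_config w e].
Proof.
apply: (@measurable_local [:: (crossed e).1; (crossed e).2]) => w w' ww' /=.
by rewrite /contour_config /= !ww' ?inE ?eqxx ?orbT.
Qed.

Definition hub_event (K : set dual_edge) : set Omega := [set w | hub (contour_config w) K].

Lemma measurable_hub K : measurable (hub_event K).
Proof.
have mC := measurable_contour.
have mK (k : dual_edge) : measurable [set _ : Omega | K k] by exact: measurable_cst_prop.
have mD e : measurable [set w : Omega | (contour_config w `\` K) e].
  by apply: measurable_and => //; exact: measurable_not.
have mI e : measurable [set w : Omega | (contour_config w `&` K) e].
  exact: measurable_and.
rewrite (_ : hub_event K = [set w | exists k e1 e2 e3,
  (contour_config w k /\ K k /\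
   ~ exists x, contour_config w x /\ K x /\ ~ connected_in (contour_config w `&` K) k x) /\
  (infinite_contour_at (contour_config w `\` K) e1 /\
   infinite_contour_at (contour_config w `\` K) e2 /\
   infinite_contour_at (contour_config w `\` K) e3) /\
  (connected_in (contour_config w) e1 k /\ connected_in (contour_config w) e2 k /\
   connected_in (contour_config w) e3 k) /\
  (~ connected_in (contour_config w `\` K) e1 e2 /\
   ~ connected_in (contour_config w `\` K) e1 e3 /\
   ~ connected_in (contour_config w `\` K) e2 e3)]); last first.
  apply/seteqP; split=> w /=.
    move=> [k [e1 [e2 [e3 [[Ck Kk ck] [? ? ?] [? ? ?] [? ? ?]]]]]].
    exists k, e1, e2, e3; split; last by [].
    by split=> //; split=> // -[x [Cx [Kx]]]; apply; exact: ck.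
  move=> [k [e1 [e2 [e3 [[Ck [Kk ck]] [[? [? ?]] [[? [? ?]] [? [? ?]]]]]]]]].
  exists k, e1, e2, e3; split=> //; split=> // x Cx Kx.
  by apply: contrapT => kx; apply: ck; exists x.
do 4 (apply: measurable_exists => ?).
apply: measurable_and.
  apply: measurable_and => //; apply: measurable_and => //; apply: measurable_not.
  apply: measurable_exists => x; apply: measurable_and => //; apply: measurable_and => //.
  by apply: measurable_not; exact: (measurable_connected mI).
apply: measurable_and.
  by apply: measurable_and; last apply: measurable_and; exact: (measurable_infinite_contour mD).
apply: measurable_and.
  by apply: measurable_and; last apply: measurable_and; exact: (measurable_connected mC).
by apply: measurable_and; last apply: measurable_and; apply: measurable_not; exact: (measurable_connected mD).
Qed.

(* Nested binary conjunctions let [measurable_and] apply directly. *)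
Definition two_contours (w : Omega) := exists e1 e2,
  infinite_contour_at (contour_config w) e1 /\ (infinite_contour_at (contour_config w) e2 /\
  ~ connected_in (contour_config w) e1 e2).

Definition three_contours (w : Omega) := exists e1 e2 e3,
  infinite_contour_at (contour_config w) e1 /\ (infinite_contour_at (contour_config w) e2 /\
  (infinite_contour_at (contour_config w) e3 /\ (~ connected_in (contour_config w) e1 e2 /\
  (~ connected_in (contour_config w) e1 e3 /\ ~ connected_in (contour_config w) e2 e3)))).

Lemma measurable_two_contours : measurable [set w | two_contours w].
Proof.
have mC := measurable_contour.
apply: measurable_exists => e1; apply: measurable_exists => e2.
apply: measurable_and; last apply: measurable_and; by [
  exact: (measurable_infinite_contour mC)|
  apply: measurable_not; exact: (measurable_connected mC)].
Qed.

Lemma measurable_three_contours : measurable [set w | three_contours w].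
Proof.
have mC := measurable_contour.
do 3 (apply: measurable_exists => ?).
apply: measurable_and; last apply: measurable_and; last apply: measurable_and;
  last apply: measurable_and; last apply: measurable_and; by [
  exact: (measurable_infinite_contour mC)|
  apply: measurable_not; exact: (measurable_connected mC)].
Qed.

Lemma two_contours_translate u w : two_contours (translate u w) <-> two_contours w.
Proof.
suff h v s : two_contours (translate v s) -> two_contours s.
  split; first exact: h.
  move=> hw; apply: (h (- u)); rewrite (_ : translate _ _ = w)//.
  by apply/funext => v; rewrite /translate subrK.
rewrite /two_contours contour_translate => -[e1 [e2 [i1 [i2 n12]]]].
exists (shift_edge v e1), (shift_edge v e2); split; first exact/infinite_contour_shift.
by split; [exact/infinite_contour_shift|move/connected_in_shift].
Qed.

Lemma three_contours_translate u w : three_contours (translate u w) <-> three_contours w.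
Proof.
suff h v s : three_contours (translate v s) -> three_contours s.
  split; first exact: h.
  move=> hw; apply: (h (- u)); rewrite (_ : translate _ _ = w)//.
  by apply/funext => v; rewrite /translate subrK.
rewrite /three_contours contour_translate => -[e1 [e2 [e3 [i1 [i2 [i3 [n12 [n13 n23]]]]]]]].
exists (shift_edge v e1), (shift_edge v e2), (shift_edge v e3).
by do 3?[split; first exact/infinite_contour_shift];
   do 2?[split; first by move/connected_in_shift]; move/connected_in_shift.
Qed.

(** * The Burton-Keane argument for an invariant law with finite energy *)

Section uniqueness.
Context {R : realType} (Q : {measure set Omega -> \bar R}) (c : R).
Local Open Scope ereal_scope.
Hypotheses (Q1 : Q setT = 1) (c0 : (0 <= c)%R).
Hypothesis Q_inv : forall (u : vertex) (A : set Omega), u = (1, 0)%R \/ u = (0, 1)%R ->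
  measurable A -> Q (translate u @^-1` A) = Q A.
Hypothesis Q_flip : forall v (A : set Omega), measurable A ->
  Q (flip_spin v @^-1` A) <= c%:E * Q A.

Let Q_fin : Q setT < +oo. Proof. by rewrite Q1 ltry. Qed.

Let mpre u (A : set Omega) : measurable A -> measurable (translate u @^-1` A).
Proof. by move=> mA; rewrite -[X in measurable X]setTI; exact: measurable_translate. Qed.

Let mflip v (A : set Omega) : measurable A -> measurable (flip_spin v @^-1` A).
Proof. by move=> mA; rewrite -[X in measurable X]setTI; exact: measurable_flip. Qed.

Let Q_inv_nat (a b : nat) (A : set Omega) : measurable A ->
  Q (translate (a%:Z, b%:Z) @^-1` A) = Q A.
Proof.
move=> mA; elim: a => [|a IH].
  elim: b => [|b IH].
    rewrite (_ : _ @^-1` _ = A)//; apply/seteqP; split=> w;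
    rewrite /preimage /= (_ : translate _ w = w)//;
    by apply/funext => v; rewrite /translate addr0.
  rewrite -IH -(Q_inv (or_intror erefl) (mpre (0, b%:Z)%R mA)); congr (Q _).
  apply/seteqP; split=> w;
  rewrite /preimage /= (_ : translate _ (translate _ w) = translate (0%:Z, b.+1%:Z)%R w)//;
  apply/funext => v; rewrite /translate -addrA; congr (w (_ + _)%R); congr (_, _) => /=; lia.
rewrite -IH -(Q_inv (or_introl erefl) (mpre (a%:Z, b%:Z)%R mA)); congr (Q _).
apply/seteqP; split=> w;
  rewrite /preimage /= (_ : translate _ (translate _ w) = translate (a.+1%:Z, b%:Z)%R w)//;
apply/funext => v; rewrite /translate -addrA; congr (w (_ + _)%R); congr (_, _) => /=; lia.
Qed.

Let flip_negligible v (N : set Omega) : Q.-negligible N -> Q.-negligible (flip_spin v @^-1` N).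
Proof.
move=> [B [mB B0 NB]]; exists (flip_spin v @^-1` B); split; [exact: mflip| |by move=> w /NB].
by apply/eqP; rewrite eq_le measure_ge0 andbT; apply: le_trans (Q_flip v mB) _; rewrite B0 mule0.
Qed.

(** Vertices of [V] are restored one at a time: at [v] the modified configuration agrees either with
    [w] or with its flip, and preimages of null sets under a flip are null. *)
Lemma modification_negligible (V : seq vertex) (E : set Omega) : Q.-negligible E ->
  Q.-negligible [set w | exists w' : Omega, (forall v, v \notin V -> w' v = w v) /\ E w'].
Proof.
move=> E0; elim: V => [|v V IH].
  apply: negligibleS E0 => w [w' [ww' Ew']].
  by rewrite (_ : w = w')//; apply/funext => v; rewrite ww'.
apply: negligibleS (negligibleU IH (flip_negligible v IH)) => w [w' [ww' Ew']].
have [e|e] := eqVneq (w' v) (w v); [left|right]; exists w'; split=> // x xV.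
  by have [->//|xv] := eqVneq x v; apply: ww'; rewrite inE negb_or xv.
rewrite /flip_spin; case: eqP => [->|/eqP xv]; last by apply: ww'; rewrite inE negb_or xv.
by move: e; case: (w' v); case: (w v).
Qed.

(** When the modification changes the spin at [v], that flip is made first. Either it already leaves
    [A], which is a null event by [invariant_event_insensitive], or the flipped configuration is in
    [A] and falls under the induction hypothesis. *)
Lemma invariant_modification_negligible (V : seq vertex) (A : set Omega) : measurable A ->
  translate (1, 0)%R @^-1` A = A ->
  Q.-negligible [set w | A w /\ exists w' : Omega, (forall v, v \notin V -> w' v = w v) /\ ~ A w'].
Proof.
move=> mA Au; elim: V => [|v V IH].
  apply: negligibleS (negligible_set0 Q) => w [Aw [w' [ww' Aw']]].
  by apply: Aw'; rewrite (_ : w' = w)//; apply/funext => v; rewrite ww'.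
have D0 : Q.-negligible (A `\` flip_spin v @^-1` A).
  apply/negligibleP; first by apply: measurableD => //; exact: mflip.
  apply: (@invariant_event_insensitive _ Q c (1, 0)%R) => // B mB.
  by apply: Q_inv mB; left.
apply: negligibleS (negligibleU (negligibleU IH (flip_negligible v IH)) D0) => w [Aw [w' [ww' Aw']]].
have [e|e] := eqVneq (w' v) (w v).
  left; left; split=> //; exists w'; split=> // x xV.
  by have [->//|xv] := eqVneq x v; apply: ww'; rewrite inE negb_or xv.
have [Afw|Afw] := pselect (A (flip_spin v w)); last by right.
left; right; split=> //; exists w'; split=> // x xV.
rewrite /flip_spin; case: eqP => [->|/eqP xv]; last by apply: ww'; rewrite inE negb_or xv.
by move: e; case: (w' v); case: (w v).
Qed.

(** The base points of the edges of [touching m] fill [2m + 2] consecutive values of each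
    coordinate, so translates by distinct multiples of [2m + 3] are disjoint. *)
Let hub_array (m M : nat) (i : 'I_M * 'I_M) : vertex :=
  (((2 * m + 3) * i.1)%N%:Z, ((2 * m + 3) * i.2)%N%:Z).

(** The frame has [8 * ((2m + 3) * M + m + 4)] edges, and [m + 4 <= (m + 4) * M] gives the constant
    [3m + 7]. *)
Let hub_array_count (m M : nat) w : (0 < M)%N ->
  (#|[set i : 'I_M * 'I_M | `[< hub_event (touching m) (translate (hub_array m i) w) >]]%SET|
     <= M * (8 * (3 * m + 7)))%N.
Proof.
move=> M0; pose K (i : 'I_M * 'I_M) := shift_edge (- hub_array m i)%R @^-1` touching m.
pose lo : int := (- m%:Z - 1)%R; pose hi : int := ((2 * m + 3) * M)%N%:Z.
have lohi : (lo <= hi)%R by rewrite /lo /hi; lia.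
have KB i : K i `<=` in_box lo hi.
  move=> [[a b] d] /touching_in_box; case: i => i j; have := ltn_ord i; have := ltn_ord j.
  rewrite /in_box /hub_array /lo /hi /=; nia.
have disj i j : i != j -> K i `&` K j = set0.
  move=> ij; apply/seteqP; split=> // -[[a b] d] [/touching_in_box + /touching_in_box].
  rewrite /in_box /hub_array /=.
  have : (i.1 != j.1 :> nat) || (i.2 != j.2 :> nat).
    by move: ij; rewrite -negb_and; apply: contraNN => /andP[/eqP/val_inj e1 /eqP/val_inj e2];
    rewrite [i]surjective_pairing [j]surjective_pairing e1 e2.
  move: (i.1 : nat) (i.2 : nat) (j.1 : nat) (j.2 : nat) => i1 i2 j1 j2; nia.
have := @hub_count (contour_config w) _ K (frame lo hi) disj
  (fun i e => @branch_exits (contour_config w) (K i) lo hi e lohi (KB i)).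
rewrite size_frame; set X := #|_| => hX; set Z := #|_|.
have ZX : (Z <= X)%N.
  apply: subset_leq_card; apply/fintype.subsetP => i; rewrite !inE => h.
  by apply: hub_shift; rewrite -contour_translate.
apply: leq_trans ZX (leq_trans hX _); rewrite /lo /hi; nia.
Qed.

(* The right-hand side is linear in [M]: it bounds the length of the frame around an
   [M] by [M] array of disjoint translates of the square. *)
Lemma hub_probability_bound (m M : nat) : (0 < M)%N ->
  ((M * M)%:R)%:E * Q (hub_event (touching m)) <= ((M * (8 * (3 * m + 7)))%:R)%:E.
Proof.
move=> M0; pose A (i : 'I_M * 'I_M) := translate (hub_array m i) @^-1` hub_event (touching m).
have mA i : measurable (A i) by apply: mpre; exact: measurable_hub.
have QA i : Q (A i) = Q (hub_event (touching m)) by apply: Q_inv_nat; exact: measurable_hub.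
have -> : ((M * M)%:R)%:E * Q (hub_event (touching m)) =
    \int[Q]_w \sum_(i : 'I_M * 'I_M) (\1_(A i) w)%:E.
  rewrite ge0_integral_sum//; last first.
    by move=> i; apply/measurable_realfun.measurable_EFinP; exact: measurable_realfun.measurable_indic.
  rewrite (eq_bigr (fun=> Q (hub_event (touching m)))); last first.
    by move=> i _; rewrite integral_indic// setIT QA.
  by rewrite sumr_const card_prod card_ord mule_natl.
apply: (@le_trans _ _ (\int[Q]_w (cst ((M * (8 * (3 * m + 7)))%:R)%:E w))).
  apply: ge0_le_integral => //.
  - by move=> w _; apply: sume_ge0 => i _; rewrite lee_fin.
  - apply: emeasurable_sum => i.
    by apply/measurable_realfun.measurable_EFinP; exact: measurable_realfun.measurable_indic.
  - move=> w _; rewrite sumEFin lee_fin; apply: le_trans (_ : _ <=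
      #|[set i : 'I_M * 'I_M | `[< hub_event (touching m) (translate (hub_array m i) w) >]]%SET|%:R)%R _.
      rewrite -sum1_card natr_sum [leRHS]big_mkcond /=; apply: ler_sum => i _.
      rewrite indicE; have [h|h] := pselect (A i w).
        by rewrite ifT ?inE//; case: (w \in A i).
      by rewrite memNset//; case: ifP.
    by rewrite ler_nat hub_array_count.
by rewrite integral_cst// Q1 mule1.
Qed.

(** With probability [p] and [a] the constant of the bound, [M * M * p <= M * a] for every [M > 0];
    for [p > 0] this fails as soon as [M] exceeds [a / p]. *)
Lemma hub_negligible m : Q.-negligible (hub_event (touching m)).
Proof.
apply/negligibleP; first exact: measurable_hub.
have Hfin : Q (hub_event (touching m)) \is a fin_num.
  rewrite ge0_fin_numE//; apply: le_lt_trans Q_fin; apply: le_measure; rewrite ?inE//.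
  exact: measurable_hub.
have := hub_probability_bound m; rewrite -(fineK Hfin); set p := fine _ => bound.
transitivity (p%:E); first by rewrite /p fineK.
suff -> : p = 0%R by []; apply/eqP; rewrite eq_le fine_ge0// andbT leNgt; apply/negP => p0.
pose a : R := (8 * (3 * m + 7))%:R.
pose M := (Num.truncn (a / p)).+1.
have aM : (a < M%:R * p)%R by rewrite -ltr_pdivrMr// truncnS_gt.
have := bound M isT; rewrite -EFinM lee_fin [in X in (X <= _)%R]natrM [in X in (_ <= X)%R]natrM.
by rewrite -mulrA ler_pM2l ?ltr0n// leNgt -/a aM.
Qed.

Lemma inner_face_finite m : exists V : seq vertex, forall v, v \notin V -> ~~ inner_face m v.
Proof.
have fin : finite_set [set v | inner_face m v].
  apply: sub_finite_set (finite_image fst (finite_in_box (- m%:Z) m%:Z)) => v hv.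
  by exists (v, true) => //; move: hv; rewrite /inner_face /in_box /=; lia.
have /finite_seqP[V VE] := fin; exists V => v; apply: contraNN => hv.
by have : [set v | inner_face m v] v by []; rewrite VE.
Qed.

(** Three distinct infinite contours all touch a common square for some [m], and rewriting that
    square produces a hub. Hence the event is covered by countably many sets of finite modifications
    of null events. *)
Lemma three_contours_negligible : Q.-negligible [set w | three_contours w].
Proof.
have nul m : Q.-negligible [set w | exists w' : Omega,
    (forall v, ~~ inner_face m v -> w' v = w v) /\ hub_event (touching m) w'].
  have [V VP] := inner_face_finite m.
  apply: negligibleS (modification_negligible V (hub_negligible m)) => w [w' [ww' hw']].
  by exists w'; split=> // v /VP; exact: ww'.
apply: negligibleS (negligible_bigcup nul) => w [e1 [e2 [e3 [i1 [i2 [i3 [n12 [n13 n23]]]]]]]].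
have [m1 t1] := touching_exists e1; have [m2 t2] := touching_exists e2.
have [m3 t3] := touching_exists e3.
pose m := (2 + m1 + m2 + m3)%N; exists m => //; exists (merged w m); split.
  exact: merged_outer.
have m_ge2 : (2 <= m)%N by rewrite /m; lia.
apply: (@merged_hub w m m_ge2 e1 e2 e3) => //.
- by apply: touching_le t1; rewrite /m; lia.
- by apply: touching_le t2; rewrite /m; lia.
- by apply: touching_le t3; rewrite /m; lia.
Qed.

(** With exactly two infinite contours, a square touching both can be rewritten so that at most one
    is left, which leaves the invariant event [A]. By insensitivity this is a null event for each of
    the countably many squares. *)
Lemma two_contours_negligible : Q.-negligible [set w | two_contours w].
Proof.
pose A := [set w | two_contours w] `\` [set w | three_contours w].
have mA : measurable A.
  exact: measurableD measurable_two_contours measurable_three_contours.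
have Au : translate (1, 0)%R @^-1` A = A.
  apply/seteqP; split=> w [h2 h3]; split.
  - by apply/(two_contours_translate (1, 0)%R).
  - by move=> h; apply: h3; apply/three_contours_translate.
  - by apply/two_contours_translate.
  - by move=> h; apply: h3; apply/(three_contours_translate (1, 0)%R).
have nul m : Q.-negligible [set w | A w /\ exists w' : Omega,
    (forall v, ~~ inner_face m v -> w' v = w v) /\ ~ A w'].
  have [V VP] := inner_face_finite m.
  apply: negligibleS (invariant_modification_negligible V mA Au) => w [Aw [w' [ww' hw']]].
  by split=> //; exists w'; split=> // v /VP; exact: ww'.
apply: negligibleS (negligibleU three_contours_negligible (negligible_bigcup nul)) => w w2.
have [w3|w3] := pselect (three_contours w); first by left.
right; have [e1 [e2 [i1 [i2 n12]]]] := w2.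
have [m1 t1] := touching_exists e1; have [m2 t2] := touching_exists e2.
pose m := (2 + m1 + m2)%N; exists m => //; split=> //; exists (merged w m); split.
  exact: merged_outer.
move=> [[f1 [f2 [j1 [j2 nf]]]] _]; apply: nf.
have m_ge2 : (2 <= m)%N by rewrite /m; lia.
apply: (@merged_at_most_one w m m_ge2 e1 e2) => //.
- by apply: touching_le t1; rewrite /m; lia.
- by apply: touching_le t2; rewrite /m; lia.
- by move=> x ix n1 n2; apply: w3; exists e1, e2, x.
Qed.
End uniqueness.

Theorem theorem1p9 (R : realType) (Jh Jv : R) (P : probability Omega R) :
  0 < Jh -> 0 < Jv ->
  expR (- (2 * Jh)) + expR (- (2 * Jv)) + expR (- (2 * Jh) - 2 * Jv) != 1 ->
  is_torus_Ising_limit Jh Jv P ->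
  {ae (P \x P)%E, forall w : Omega * Omega,
     at_most_one_infinite_contour (contour_config (xor_spin w))}.
Proof.
move=> Jh0 Jv0 _ PJ.
have [B [mB B0 hB]] := @two_contours_negligible _ (xor_law P) (expR (4 * (Jh + Jv)))
  (xor_lawT P) (expR_ge0 _) (fun u A => @xor_law_translate _ _ _ P PJ u A)
  (fun v A => @xor_law_flip _ _ _ P Jh0 Jv0 PJ v A).
exists (xor_config @^-1` B); split=> //.
  by rewrite -[X in measurable X]setTI; exact: measurable_xor.
move=> w /= nw; apply: hB; apply: contrapT => n2; apply: nw => e f ie if_.
by apply: contrapT => ef; apply: n2; exists e, f.
Qed.
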